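(* Let $B\subset\mathbb{R}^2$ be a symmetric oval and let $F\subset\mathbb{R}^2$ be a convex disk (a compact convex set with non-empty interior). Then for every $\lambda>0$ $$p_B(\partial F)-2\lambda\le 2\lambda N_\lambda(F,B)\le p_B(\partial F)+\lambda\,p_B(\partial B).$$
   Context: A symmetric oval $B\subset\mathbb{R}^2$ is a compact convex set with non-empty interior, symmetric about its center. $\|\cdot\|_B$ is the norm on $\mathbb{R}^2$ with unit ball $B$ (centered at the origin), and $p_B(\gamma)$ is the length of a curve $\gamma$ in this norm. For $\lambda>0$ let $A_{F,B,\lambda}$ be the family of all sets homothetic to $B$ in the ratio $\lambda$ (translates of $\lambda B$) which have at least one point in common with $F$ and have only boundary points in common with $F$. $N_\lambda(F,B)$ is the greatest integer $k$ such that $A_{F,B,\lambda}$ contains $k$ sets with pairwise disjoint interiors. *)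

(* Defs.v *)
From HB Require Import structures.
From mathcomp Require Import all_boot all_order all_algebra.
From mathcomp Require Import all_classical all_reals all_analysis.

Set Implicit Arguments.
Unset Strict Implicit.
Unset Printing Implicit Defensive.

Import Order.TTheory GRing.Theory Num.Theory.
Import numFieldNormedType.Exports.

Local Open Scope classical_set_scope.
Local Open Scope ring_scope.

Section Defs.
Context {R : realType}.
Local Notation plane := 'rV[R]_2.
Implicit Types (A B F X : set plane) (c : plane) (lambda : R).

Definition convex_disk A : Prop :=
  [/\ compact A, convex_set (A : set (convex_lmodType plane)) & A° !=set0].

(* The center is a parameter; by compactness it is determined by B. *)
Definition symmetric_oval c B : Prop :=
  convex_disk B /\ forall x, B x -> B (c *+ 2 - x).

Definition boundary A : set plane := closure A `\` A°.

(* The norm whose unit ball is B - c: the Minkowski functional of B - c. *)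
Definition oval_norm c B (v : plane) : R :=
  inf [set t : R | 0 < t /\ B (c + t^-1 *: v)].

(* Length of g restricted to [0, 1]: supremum of the lengths of the inscribed
   polygonal lines, as in [variation] for real functions. *)
Definition curve_length c B (g : R -> plane) : \bar R :=
  ereal_sup [set (let G := g \o nth 1 (0 :: s) in
                  \sum_(0 <= i < size s) oval_norm c B (G i.+1 - G i))%:E
            | s in itv_partition 0 1].

Definition simple_closed_parametrization (C : set plane) (g : R -> plane)
  : Prop :=
  [/\ {within `[0, 1], continuous g}, g 0 = g 1,
      {in `[0, 1[ &, injective g} & g @` `[0, 1] = C].

(* All simple closed parametrizations of C have the same length, so the
   infimum only serves to select this common value; it is +oo if there is
   no parametrization. *)
Definition closed_curve_length c B (C : set plane) : \bar R :=
  ereal_inf [set curve_length c B g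
            | g in [set g | simple_closed_parametrization C g]].

Definition homothetic_copy B lambda X : Prop :=
  exists v : plane, X = [set v + lambda *: b | b in B].

Definition touching_family F B lambda : set (set plane) :=
  [set X | [/\ homothetic_copy B lambda X, X `&` F !=set0
             & X `&` F `<=` boundary X `&` boundary F]].

Definition touching_packing F B lambda (k : nat) : Prop :=
  exists X : 'I_k -> set plane,
    [/\ injective X, forall i, touching_family F B lambda (X i)
      & trivIset setT (fun i => (X i)°)].

Definition is_touching_number F B lambda (N : nat) : Prop :=
  touching_packing F B lambda N /\
  forall k, touching_packing F B lambda k -> (k <= N)%N.

End Defs.

(* Main.v *)
Require Import Defs.
From HB Require Import structures.
From mathcomp Require Import all_boot all_order all_algebra.
From mathcomp Require Import all_classical all_reals all_analysis.
From mathcomp Require Import zify ring lra.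

Set Implicit Arguments.
Unset Strict Implicit.
Unset Printing Implicit Defensive.

Import Order.TTheory GRing.Theory Num.Theory.
Import numFieldNormedType.Exports.

Local Open Scope classical_set_scope.
Local Open Scope ring_scope.

(** Write [p] for the norm with unit ball [B - c].  A translate of [lambda B]
    touches F exactly when its centre lies on the boundary of the parallel body
    [G = F + lambda (B - c)], and two such translates do not overlap exactly when
    their centres are at distance at least [2 lambda].

    Any norm in the plane agrees on a given finite set of vectors with a finite
    sum of absolute values of linear forms that is nowhere larger than the norm.
    For such a sum, a convex closed polygon has length twice the sum of the
    widths in the given forms, whereas an arbitrary closed polygon is at least as
    long; as widths are monotone and Minkowski additive, so are the perimeters
    involved.  The upper bound follows: the k centres in cyclic order form a
    polygon of length at least [2 lambda k] inscribed in G.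

    For the lower bound, walk around the boundary of G, each time to the last
    point at distance [2 lambda].  The points reached before the walk closes up
    are separated.  A chord of length at most [2 lambda] is covered by the
    touching copies centred at its ends and so avoids the interior of F; hence
    the polygon of the walk encloses F, and p(F) is at most its length.  Starting
    where the number of steps is minimal costs only one additional chord. *)

(** * Variation of closed sequences *)

Section Variation.
Context {R : realType}.
Implicit Types (f : nat -> R) (n : nat).

Lemma norm_telescope_le f a b : (a <= b)%N ->
  `|f b - f a| <= \sum_(a <= k < b) `|f k.+1 - f k|.
Proof.
move=> ab; rewrite -telescope_sumr //; exact: ler_norm_sum.
Qed.

(** A closed sequence has to travel from [f j] to [f i] and back, covering the difference at least
    once each way. *)
Lemma closed_variation_ge f n i j : f n = f 0%N -> (i <= n)%N -> (j <= n)%N ->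
  2 * (f i - f j) <= \sum_(0 <= k < n) `|f k.+1 - f k|.
Proof.
move=> f0; wlog: f i j f0 / (i <= j)%N => [hw ni nj|ij ni nj].
  have [ij|/ltnW ji] := leqP i j; first exact: hw.
  have fN : (- f n) = - f 0%N by rewrite f0.
  have := hw (fun k => - f k) j i fN ji nj ni.
  under eq_bigr do rewrite -opprD normrN.
  by lra.
rewrite (big_cat_nat (n := i)) //= (big_cat_nat (n := j) (m := i)) //=.
have := norm_telescope_le f (leq0n i); have := norm_telescope_le f ij.
have := norm_telescope_le f nj; rewrite f0.
have := ler_norm (f i - f 0%N); have := ler_norm (f 0%N - f j).
have := ler_norm (f i - f j); rewrite (distrC (f i)).
by lra.
Qed.

(** Discrete form of unimodality: no level sees four terms, in this order, low, high, low, high. *)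
Definition non_alternating f n := forall i j k l (c : R),
  (i < j)%N -> (j < k)%N -> (k < l)%N -> (l <= n)%N ->
  f i <= c -> f k <= c -> c < f j -> c < f l -> False.

Lemma variation_nondecreasing f a b : (a <= b)%N ->
  (forall i, (a <= i < b)%N -> f i <= f i.+1) ->
  \sum_(a <= k < b) `|f k.+1 - f k| = f b - f a.
Proof.
move=> ab h; rewrite -telescope_sumr //; apply: eq_big_nat => i /h.
by rewrite -subr_ge0 => /ger0_norm.
Qed.

Lemma variation_nonincreasing f a b : (a <= b)%N ->
  (forall i, (a <= i < b)%N -> f i.+1 <= f i) ->
  \sum_(a <= k < b) `|f k.+1 - f k| = f a - f b.
Proof.
move=> ab h.
have := @variation_nondecreasing (fun i => - f i) a b ab.
rewrite opprK (addrC (- f b)) => <- => [|i /h]; last by rewrite lerN2.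
by apply: eq_bigr => i _; rewrite -opprD normrN.
Qed.

Lemma argmax_le f n : exists2 M, (M <= n)%N &
  forall i, (i <= n)%N -> f i <= f M.
Proof.
elim: n => [|n [M Mn hM]]; first by exists 0%N => // i; rewrite leqn0 => /eqP->.
have [h|h] := leP (f n.+1) (f M).
  exists M; first exact: leqW.
  by move=> i; rewrite leq_eqVlt => /predU1P[->//|]; rewrite ltnS => /hM.
exists n.+1 => // i; rewrite leq_eqVlt => /predU1P[->//|].
by rewrite ltnS => /hM /le_trans; apply; exact: ltW.
Qed.

(** Cut at a minimum and at a maximum, the sequence is monotone on each of the three pieces, so the
    variation telescopes to twice the difference of the extreme values. *)
Lemma non_alternating_variation_le f n : f n = f 0%N ->
  non_alternating f n -> non_alternating (fun i => - f i) n ->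
  exists a b, [/\ (a <= n)%N, (b <= n)%N &
    \sum_(0 <= k < n) `|f k.+1 - f k| <= 2 * (f a - f b)].
Proof.
move=> f0 nf nNf.
have [M Mn hM] := argmax_le f n.
have [m mn hm'] := argmax_le (fun i => - f i) n.
have hm i : (i <= n)%N -> f m <= f i by move=> /hm'; rewrite lerN2.
clear hm'; exists M, m; split => //.
(* Negation exchanges the two extrema, and with them the two non-alternation hypotheses. *)
wlog mM : f M m f0 Mn mn hM hm nf nNf / (m <= M)%N => [hw|].
  have [mM|/ltnW Mm] := leqP m M; first exact: hw.
  have fN : - f n = - f 0%N by rewrite f0.
  have nNNf : non_alternating (fun i => - - f i) n.
    by move=> i j k l c; rewrite !opprK; exact: nf.
  have hM' i : (i <= n)%N -> - f i <= - f m by move=> /hm; rewrite lerN2.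
  have hm' i : (i <= n)%N -> - f M <= - f i by move=> /hM; rewrite lerN2.
  have := hw (fun i => - f i) m M fN mn Mn hM' hm' nNf nNNf Mm.
  under eq_bigr do rewrite -opprD normrN.
  by lra.
rewrite (big_cat_nat (n := m)) //= (big_cat_nat (n := M) (m := m)) //=.
(* A step in the wrong direction produces the forbidden pattern: at [i], [i.+1], [m], [M] here, at
   [m], [i], [i.+1], [M] on the middle piece, and at [m], [M], [i], [i.+1] on the last one. *)
rewrite [X in X + _]variation_nonincreasing //; last first.
  move=> i /andP[_ im]; rewrite leNgt; apply/negP => lt_f.
  have jm : (i.+1 < m)%N.
    rewrite ltn_neqAle im andbT; apply/negP => /eqP im'.
    by have := hm i ltac:(lia); rewrite -im'; lra.
  have mM' : (m < M)%N.
    rewrite ltn_neqAle mM andbT; apply/negP => /eqP mM'.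
    by have := hm i ltac:(lia); have := hM i.+1 ltac:(lia); rewrite -mM'; lra.
  have /(_ (f i)) := nf i i.+1 m M.
  apply => //; first by apply: hm; lia.
  by apply: lt_le_trans lt_f _; apply: hM; lia.
rewrite [X in _ + (X + _)]variation_nondecreasing //; last first.
  move=> i /andP[mi iM]; rewrite leNgt; apply/negP => lt_f.
  have mi' : (m < i)%N.
    rewrite ltn_neqAle mi andbT; apply/negP => /eqP im'.
    by have := hm i.+1 ltac:(lia); rewrite im'; lra.
  have iM' : (i.+1 < M)%N.
    rewrite ltn_neqAle iM andbT; apply/negP => /eqP im'.
    by have := hM i ltac:(lia); rewrite -im'; lra.
  have /(_ (f i.+1)) := nf m i i.+1 M.
  apply => //; first by apply: hm; lia.
  by apply: lt_le_trans lt_f _; apply: hM; lia.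
rewrite [X in _ + (_ + X)]variation_nonincreasing //; last first.
  move=> i /andP[Mi im]; rewrite leNgt; apply/negP => lt_f.
  have Mi' : (M < i)%N.
    rewrite ltn_neqAle Mi andbT; apply/negP => /eqP im'.
    by have := hM i.+1 ltac:(lia); rewrite im'; lra.
  have mM' : (m < M)%N.
    rewrite ltn_neqAle mM andbT; apply/negP => /eqP mM'.
    by have := hm i ltac:(lia); have := hM i.+1 ltac:(lia); rewrite -mM'; lra.
  have /(_ (f i)) := nf m M i i.+1.
  apply => //; first by apply: hm; lia.
  by apply: lt_le_trans lt_f _; apply: hM; lia.
by rewrite f0; lra.
Qed.

End Variation.

(** * Gauges in the plane and their radial functions *)

Section Plane.
Context {R : realType}.
Local Notation plane := 'rV[R]_2.
Implicit Types (u v w x y z : plane) (p : plane -> R) (a b c k t : R).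

Definition dot v w : R := v 0 0 * w 0 0 + v 0 1 * w 0 1.

Lemma dotDr v x y : dot v (x + y) = dot v x + dot v y.
Proof. by rewrite /dot !mxE; ring. Qed.
Lemma dotBr v x y : dot v (x - y) = dot v x - dot v y.
Proof. by rewrite /dot !mxE; ring. Qed.
Lemma dotNr v x : dot v (- x) = - dot v x.
Proof. by rewrite /dot !mxE; ring. Qed.
Lemma dotZr v a x : dot v (a *: x) = a * dot v x.
Proof. by rewrite /dot !mxE; ring. Qed.
Lemma dotC v x : dot v x = dot x v.
Proof. by rewrite /dot; ring. Qed.
Lemma dotDl v x y : dot (x + y) v = dot x v + dot y v.
Proof. by rewrite dotC dotDr !(dotC v). Qed.
Lemma dotBl v x y : dot (x - y) v = dot x v - dot y v.
Proof. by rewrite dotC dotBr !(dotC v). Qed.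
Lemma dotNl v x : dot (- x) v = - dot x v.
Proof. by rewrite dotC dotNr (dotC v). Qed.
Lemma dotZl v a x : dot (a *: x) v = a * dot x v.
Proof. by rewrite dotC dotZr (dotC v). Qed.

Lemma dot0r v : dot v 0 = 0.
Proof. by rewrite /dot !mxE; ring. Qed.
Lemma dot0l v : dot 0 v = 0.
Proof. by rewrite dotC dot0r. Qed.

Lemma ord2P (P : 'I_2 -> Prop) : P 0 -> P 1 -> forall i, P i.
Proof.
by move=> P0 P1 [[|[|//]] hi]; [have -> : Ordinal hi = 0 by apply: val_inj|
  have -> : Ordinal hi = 1 by apply: val_inj].
Qed.

Lemma dot_gt0 v : v != 0 -> 0 < dot v v.
Proof.
move=> v0; rewrite lt0r; apply/andP; split; last by rewrite /dot; nra.
apply: contra v0; rewrite /dot -!expr2 paddr_eq0 ?sqr_ge0// !sqrf_eq0.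
by move=> /andP[/eqP v0 /eqP v1]; apply/eqP/rowP; apply: ord2P; rewrite mxE.
Qed.

Definition dir t : plane := \row_i (if i == 0 then cos t else sin t).

Lemma dir_neq0 t : dir t != 0.
Proof.
apply/eqP => /rowP h; have := cos2Dsin2 t.
have := h 0; have := h 1; rewrite !mxE /= => -> ->.
by rewrite expr0n /= addr0 => /eqP; rewrite eq_sym oner_eq0.
Qed.

Lemma dot_dir t : dot (dir t) (dir t) = 1.
Proof. by rewrite /dot !mxE /= -(cos2Dsin2 t); ring. Qed.

Lemma dirDpi t : dir (t + pi) = - dir t.
Proof. by apply/rowP; apply: ord2P; rewrite !mxE /= ?cosDpi ?sinDpi. Qed.

Lemma dirD2pi t : dir (t + pi *+ 2) = dir t.
Proof. by rewrite mulr2n addrA !dirDpi opprK. Qed.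

(** For [a <= b <= c <= a + pi] the coefficients are nonnegative, so sublinearity of a gauge can be
    applied to this relation. *)
Lemma dir_between a b c :
  sin (c - a) *: dir b = sin (c - b) *: dir a + sin (b - a) *: dir c.
Proof. by apply/rowP; apply: ord2P; rewrite !mxE /= !sinB; ring. Qed.

Lemma polar v : v != 0 ->
  exists t r, [/\ 0 <= t, t < pi *+ 2, 0 < r & v = r *: dir t].
Proof.
move=> v0; have d0 := dot_gt0 v0.
pose r := Num.sqrt (dot v v).
have r0 : 0 < r by rewrite sqrtr_gt0.
have r2 : r ^+ 2 = v 0 0 ^+ 2 + v 0 1 ^+ 2.
  by rewrite sqr_sqrtr ?(ltW d0)// /dot; ring.
pose q := v 0 0 / r; pose s := v 0 1 / r.
have qs : q ^+ 2 + s ^+ 2 = 1.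
  rewrite /q /s !exprMn -mulrDl -r2 -exprMn divff ?expr1n //; exact: lt0r_neq0.
have q1 : -1 <= q <= 1 by apply/andP; split; nra.
have Ec : cos (acos q) = q by rewrite acosK ?in_itv.
have Es : sin (acos q) = `|s|.
  by rewrite sin_acos // -(sqrtr_sqr s); congr (Num.sqrt _); rewrite -qs; ring.
have vE0 : v 0 0 = r * q by rewrite /q mulrCA divff ?mulr1 //; exact: lt0r_neq0.
have vE1 : v 0 1 = r * s by rewrite /s mulrCA divff ?mulr1 //; exact: lt0r_neq0.
have pi0 := pi_gt0 R.
have [s0|s0] := leP 0 s.
  exists (acos q), r; split => //; first exact: acos_ge0.
    by have := acos_lepi q1; lra.
  by apply/rowP; apply: ord2P; rewrite !mxE /= ?Ec ?Es ?vE0 ?vE1 ?ger0_norm.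
exists (pi *+ 2 - acos q), r; split => //.
- by have := acos_lepi q1; lra.
- rewrite ltrBlDr ltrDl acos_gt0 //; apply/andP; split; first by lra.
  by nra.
- have cE : cos (pi *+ 2 - acos q) = q.
    by rewrite addrC cosD2pi cosN.
  have sE : sin (pi *+ 2 - acos q) = s.
    by rewrite addrC sinD2pi sinN Es ltr0_norm // opprK.
  by apply/rowP; apply: ord2P; rewrite !mxE /= ?cE ?sE ?vE0 ?vE1.
Qed.

Lemma dir_inj s t : 0 <= s < pi *+ 2 -> 0 <= t < pi *+ 2 -> dir s = dir t -> s = t.
Proof.
wlog st : s t / s <= t => [hw hs ht hd|hs ht hd].
  by have [st|/ltW ts] := leP s t; [exact: hw|apply/esym; apply: hw].
apply/eqP; rewrite eq_le st /= leNgt; apply/negP => lt_st.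
have : 0 < sin ((t - s) / 2) by apply: sin_gt0_pi; lra.
have c1 : cos (t - s) = 1.
  have := dot_dir t; rewrite -{1}hd /dot !mxE /= cosB => <-; ring.
have := cos_mulr2n ((t - s) / 2).
have -> : (t - s) / 2 *+ 2 = t - s by lra.
rewrite c1.
by have := cos2Dsin2 ((t - s) / 2); nra.
Qed.

(** A possibly asymmetric norm: F and its parallel body need not be symmetric about the chosen
    interior point, so evenness is a separate hypothesis where it is used. *)
Definition is_gauge p : Prop :=
  [/\ forall x y, p (x + y) <= p x + p y,
      forall a x, 0 <= a -> p (a *: x) = a * p x
    & forall x, x != 0 -> 0 < p x].

(** The point where the ray at angle [t] leaves the unit disk of [p]. *)
Definition radial p t : plane := (p (dir t))^-1 *: dir t.

Section Gauge.
Variable p : plane -> R.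
Hypothesis hp : is_gauge p.

Lemma gaugeD x y : p (x + y) <= p x + p y. Proof. by case: hp. Qed.
Lemma gaugeZ a x : 0 <= a -> p (a *: x) = a * p x. Proof. by case: hp => _ + _; apply. Qed.
Lemma gauge_gt0 x : x != 0 -> 0 < p x. Proof. by case: hp => _ _; apply. Qed.
Lemma gauge0 : p 0 = 0. Proof. by have := @gaugeZ 0 0 (lexx _); rewrite scale0r mul0r. Qed.
Lemma gauge_ge0 x : 0 <= p x.
Proof. by have [->|/gauge_gt0/ltW//] := eqVneq x 0; rewrite gauge0. Qed.
Lemma gauge_dir_gt0 t : 0 < p (dir t). Proof. exact/gauge_gt0/dir_neq0. Qed.

Lemma gauge_radial t : p (radial p t) = 1.
Proof.
by rewrite gaugeZ ?invr_ge0 ?gauge_ge0 // mulVf // gt_eqF // gauge_dir_gt0.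
Qed.

Lemma radialD2pi t : radial p (t + pi *+ 2) = radial p t.
Proof. by rewrite /radial dirD2pi. Qed.

Lemma radialDpi t : radial p (t + pi) = - ((p (- dir t))^-1 *: dir t).
Proof. by rewrite /radial dirDpi; exact: scalerN. Qed.

Lemma radial_surj v : v != 0 ->
  exists2 t, 0 <= t < pi *+ 2 & v = p v *: radial p t.
Proof.
move=> /polar[t [r [t0 t2 r0 vE]]]; exists t; first by rewrite t0.
rewrite vE gaugeZ ?ltW // /radial scalerA -mulrA divff ?mulr1 //.
exact/lt0r_neq0/gauge_dir_gt0.
Qed.

Lemma radial_surj1 v : p v = 1 ->
  exists2 t, 0 <= t < pi *+ 2 & v = radial p t.
Proof.
move=> v1; have v0 : v != 0.
  by apply/eqP => v0; move: v1; rewrite v0 gauge0 => /esym/eqP; rewrite oner_eq0.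
by have [t ht] := radial_surj v0; rewrite v1 scale1r; exists t.
Qed.

Lemma radial_inj s t : 0 <= s < pi *+ 2 -> 0 <= t < pi *+ 2 ->
  radial p s = radial p t -> s = t.
Proof.
move=> hs ht; rewrite /radial; set a := (p (dir s))^-1; set b := (p (dir t))^-1.
move=> h; apply: dir_inj => //.
have a0 : 0 < a by rewrite invr_gt0 gauge_dir_gt0.
have b0 : 0 < b by rewrite invr_gt0 gauge_dir_gt0.
have : a ^+ 2 = b ^+ 2.
  have : dot (a *: dir s) (a *: dir s) = dot (b *: dir t) (b *: dir t) by rewrite h.
  by rewrite !dotZl !dotZr !dot_dir !mulr1 -!expr2.
move/eqP; rewrite eqrXn2 ?ltW// => /eqP ab; move: h; rewrite ab.
by move/(scalerI (lt0r_neq0 b0)).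
Qed.

Lemma dot_radial_gt v c t : (c < dot v (radial p t)) = (c * p (dir t) < dot v (dir t)).
Proof. by rewrite dotZr mulrC ltr_pdivlMr ?gauge_dir_gt0. Qed.
Lemma dot_radial_le v c t : (dot v (radial p t) <= c) = (dot v (dir t) <= c * p (dir t)).
Proof. by rewrite leNgt dot_radial_gt -leNgt. Qed.

Lemma gauge_between a b c : a <= b -> b <= c -> c <= a + pi ->
  sin (c - a) * p (dir b) <= sin (c - b) * p (dir a) + sin (b - a) * p (dir c).
Proof.
move=> ab bc ca.
have s1 : 0 <= sin (c - a) by apply: sin_ge0_pi; lra.
have s2 : 0 <= sin (c - b) by apply: sin_ge0_pi; lra.
have s3 : 0 <= sin (b - a) by apply: sin_ge0_pi; lra.
by rewrite -!gaugeZ // dir_between gaugeD.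
Qed.

(* [dot v - k p] is superlinear, hence positive on the cone of two directions
   as soon as it is positive on both. *)
Lemma dot_radial_between_gt v k a b c : 0 <= k -> a < b -> b < c -> c < a + pi ->
  k < dot v (radial p a) -> k < dot v (radial p c) -> k < dot v (radial p b).
Proof.
move=> k0 ab bc ca; rewrite !dot_radial_gt => ha hc.
have s1 : 0 < sin (c - a) by apply: sin_gt0_pi; lra.
have s2 : 0 < sin (c - b) by apply: sin_gt0_pi; lra.
have s3 : 0 < sin (b - a) by apply: sin_gt0_pi; lra.
have hb := gauge_between (ltW ab) (ltW bc) (ltW ca).
rewrite -(ltr_pM2l s1) -dotZr dir_between dotDr !dotZr.
have := ltr_pM2l s2 (k * p (dir a)) (dot v (dir a)); rewrite ha => h1.
have := ltr_pM2l s3 (k * p (dir c)) (dot v (dir c)); rewrite hc => h2.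
have := ler_wpM2l k0 hb.
by lra.
Qed.

Lemma dot_radial_between_le v k a b c : k < 0 -> a < b -> b < c -> c < a + pi ->
  dot v (radial p a) <= k -> dot v (radial p c) <= k -> dot v (radial p b) <= k.
Proof.
move=> k0 ab bc ca ha hc; rewrite leNgt; apply/negP => hb.
(* A level strictly between [k] and both 0 and the value at [b]: the weak bounds become strict for
   [- v], and [- k'] is nonnegative. *)
pose k' := (k + Num.min (dot v (radial p b)) 0) / 2.
have mb : Num.min (dot v (radial p b)) 0 <= dot v (radial p b) by rewrite ge_min lexx.
have m0 : Num.min (dot v (radial p b)) 0 <= 0 by rewrite ge_min lexx orbT.
have mk : k < Num.min (dot v (radial p b)) 0 by rewrite lt_min hb.
have k'0 : 0 <= - k' by rewrite /k'; lra.
have := @dot_radial_between_gt (- v) (- k') a b c k'0 ab bc ca.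
by rewrite !dotNl !ltrN2 /k' => /(_ ltac:(lra) ltac:(lra)); lra.
Qed.

Lemma dot_radial_opp_gt v k a : 0 <= k ->
  k < dot v (radial p a) -> k < dot v (radial p (a + pi)) -> False.
Proof.
move=> k0; rewrite !dot_radial_gt dirDpi dotNr => h1 h2.
have := gauge_ge0 (dir a); have := gauge_ge0 (- dir a).
by nra.
Qed.

Lemma dot_radial_opp_le v k a : k < 0 ->
  dot v (radial p a) <= k -> dot v (radial p (a + pi)) <= k -> False.
Proof.
move=> k0; rewrite !dot_radial_le dirDpi dotNr => h1 h2.
have := gauge_dir_gt0 a; have := gauge_ge0 (- dir a).
by nra.
Qed.

(** A line crosses a convex curve at most twice. For [c >= 0] consider the two high angles, for
    [c < 0] the two low ones: either they are antipodal, which is impossible, or on one side they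
    are less than pi apart and force the angle between them to the same side of the level. *)
Lemma radial_non_alternating v c a1 a2 a3 a4 :
  a1 < a2 -> a2 < a3 -> a3 < a4 -> a4 < a1 + pi *+ 2 ->
  dot v (radial p a1) <= c -> dot v (radial p a3) <= c ->
  c < dot v (radial p a2) -> c < dot v (radial p a4) -> False.
Proof.
move=> h12 h23 h34 h41 f1 f3 f2 f4.
have [c0|c0] := leP 0 c.
  have [h|h|h] := ltgtP a4 (a2 + pi).
  - by have := dot_radial_between_gt c0 h23 h34 h f2 f4; lra.
  - rewrite -radialD2pi in f2; rewrite -radialD2pi in f1.
    have := @dot_radial_between_gt v c a4 (a1 + pi *+ 2) (a2 + pi *+ 2) c0.
    by move=> /(_ ltac:(lra) ltac:(lra) ltac:(lra) f4 f2); lra.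
  - by rewrite h in f4; exact: dot_radial_opp_gt f2 f4.
have [h|h|h] := ltgtP a3 (a1 + pi).
- by have := dot_radial_between_le c0 h12 h23 h f1 f3; lra.
- rewrite -radialD2pi in f1.
  have := @dot_radial_between_le v c a3 a4 (a1 + pi *+ 2) c0.
  by move=> /(_ ltac:(lra) ltac:(lra) ltac:(lra) f3 f1); lra.
- by rewrite h in f3; exact: dot_radial_opp_le f1 f3.
Qed.

(** During one turn around a convex curve a linear form rises once and falls once. *)
Lemma radial_variation_le v (s : nat -> R) n :
  (forall i, (i < n)%N -> s i <= s i.+1) -> s n = s 0%N + pi *+ 2 ->
  exists (a b : nat), [/\ (a <= n)%N, (b <= n)%N &
    \sum_(0 <= k < n) `|dot v (radial p (s k.+1)) - dot v (radial p (s k))| <=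
    2 * (dot v (radial p (s a)) - dot v (radial p (s b)))].
Proof.
move=> sS sn.
have s_homo i j : (i <= j)%N -> (j <= n)%N -> s i <= s j.
  elim: j => [|j IH]; first by rewrite leqn0 => /eqP->.
  rewrite leq_eqVlt => /predU1P[->//|]; rewrite ltnS => ij jn.
  by apply: le_trans (sS _ jn); apply: IH => //; exact: ltnW.
have nalt w : non_alternating (fun i => dot w (radial p (s i))) n.
  move=> i j k l c ij jk kl ln fi fk fj fl.
  (* The angles may repeat; terms on different sides of the level [c] cannot have the same angle,
     which makes these inequalities strict. *)
  have hij : s i < s j.
    rewrite lt_neqAle s_homo 1?andbT; [|lia|lia].
    by apply/eqP => e; move: fi fj; rewrite e; lra.
  have hjk : s j < s k.
    rewrite lt_neqAle s_homo 1?andbT; [|lia|lia].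
    by apply/eqP => e; move: fj fk; rewrite e; lra.
  have hkl : s k < s l.
    rewrite lt_neqAle s_homo 1?andbT; [|lia|lia].
    by apply/eqP => e; move: fk fl; rewrite e; lra.
  have hli : s l < s i + pi *+ 2.
    rewrite lt_neqAle; apply/andP; split.
      by apply/eqP => e; move: fl fi; rewrite e radialD2pi; lra.
    by have := s_homo _ _ ln (leqnn n); have := s_homo 0%N i (leq0n _) ltac:(lia); lra.
  exact: radial_non_alternating fi fk fj fl.
apply: (@non_alternating_variation_le _ (fun i => dot v (radial p (s i)))).
- by rewrite sn radialD2pi.
- exact: nalt.
- by move=> i j k l c; rewrite -!dotNl; exact: nalt.
Qed.

End Gauge.

Lemma gauge_radial_antipodal p q t : is_gauge p -> (forall x, p (- x) = p x) ->
  is_gauge q ->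
  p (radial q (t + pi) - radial q t) = p (radial q (t + pi)) + p (radial q t).
Proof.
move=> hp pN hq.
have key a b v : 0 <= a -> 0 <= b ->
    p (- (a *: v) - b *: v) = p (- (a *: v)) + p (b *: v).
  move=> a0 b0; rewrite -opprD -scalerDl !pN !gaugeZ ?addr_ge0 //.
  by rewrite mulrDl.
by rewrite radialDpi key // invr_ge0 (gauge_ge0 hq).
Qed.
End Plane.

(** * Duality, and norms as sums of absolute values of linear forms *)

(* The default value closes up the angles listed in s. *)
Definition cyclic_nth {R : realType} (s : seq R) (i : nat) : R :=
  nth (nth 0 s 0 + pi *+ 2) s i.

Lemma cyclic_nth_closed {R : realType} (s : seq R) : (0 < size s)%N ->
  cyclic_nth s (size s) = cyclic_nth s 0 + pi *+ 2.
Proof.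
move=> s0; rewrite /cyclic_nth nth_default //; congr (_ + _).
exact: set_nth_default.
Qed.

Lemma cyclic_nth_homo {R : realType} (s : seq R) : sorted <=%R s ->
  (forall t, t \in s -> 0 <= t < pi *+ 2) ->
  forall i, (i < size s)%N -> cyclic_nth s i <= cyclic_nth s i.+1.
Proof.
move=> ss hs i lin; have [lin'|lin'] := ltnP i.+1 (size s).
  by apply: (sorted_leq_nth le_trans lexx _ ss) => //; rewrite inE.
have -> : i.+1 = size s by lia.
have s0 : (0 < size s)%N by lia.
rewrite cyclic_nth_closed //.
have /hs/andP[_ h1] : cyclic_nth s i \in s by rewrite mem_nth.
have /hs/andP[h2 _] : cyclic_nth s 0 \in s by rewrite mem_nth.
by lra.
Qed.

Section GaugeContinuity.
Context {R : realType}.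
Local Notation plane := 'rV[R]_2.
Implicit Types (u v w x y z : plane) (a b c k t : R).

Lemma coord_le_norm v i : `|v 0 i| <= `|v|.
Proof.
have -> : `|v| = mx_norm v by [].
by rewrite mx_normrE; apply/bigmax_geP; right; exists (0, i).
Qed.

Lemma nbhs_planeP x (A : set plane) :
  nbhs x A <-> exists2 e : R, 0 < e & forall y, `|x - y| < e -> A y.
Proof.
have bE : @ball _ plane = ball_ Num.norm := @mx_norm_ball R 1 2.
split=> [/nbhs_ballP[e e0 h]|[e e0 h]].
  by exists e => // y xy; apply: h; rewrite bE.
by apply/nbhs_ballP; exists e => // y; rewrite bE => /h.
Qed.

Lemma continuous_dot v : continuous (dot v).
Proof.
have h i : continuous (fun x : plane => v 0 i * x 0 i).
  move=> x; apply: (@continuousM _ _ (cst (v 0 i)) (fun x : plane => x 0 i)).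
    exact: cst_continuous.
  exact: coord_continuous.
move=> x; apply: (@continuousD _ _ _ (fun x : plane => v 0 0 * x 0 0)
  (fun x : plane => v 0 1 * x 0 1)); exact: h.
Qed.

Lemma vec_decomp v : v = v 0 0 *: delta_mx 0 0 + v 0 1 *: delta_mx 0 1.
Proof. by apply/rowP; apply: ord2P; rewrite !mxE /= ; ring. Qed.

Lemma continuous_dir : continuous (@dir R).
Proof.
have -> : @dir R = fun t => cos t *: delta_mx 0 0 + sin t *: delta_mx 0 1.
  by apply/funext => t; rewrite [LHS]vec_decomp !mxE.
move=> t; apply: cvgD; apply: cvgZ; try exact: cvg_cst.
  exact: continuous_cos.
exact: continuous_sin.
Qed.

Variable p : plane -> R.
Hypothesis hp : is_gauge p.

Lemma gauge_le_norm : exists2 C, 0 < C & forall v, p v <= C * `|v|.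
Proof.
pose e0 : plane := delta_mx 0 0; pose e1 : plane := delta_mx 0 1.
pose C := 1 + (p e0 + p (- e0)) + (p e1 + p (- e1)).
have g0 x := gauge_ge0 hp x.
have h (e : plane) a b : `|a| <= b -> p (a *: e) <= b * (p e + p (- e)).
  move=> ab; have [a0|a0] := leP 0 a.
    rewrite gaugeZ //; move: ab; rewrite ger0_norm // => ab.
    by have := g0 e; have := g0 (- e); nra.
  rewrite -[_ *: _]opprK -scaleNr -scalerN gaugeZ //; last by lra.
  move: ab; rewrite ltr0_norm // => ab.
  by have := g0 e; have := g0 (- e); nra.
exists C => [|v].
  by rewrite /C; have := g0 e0; have := g0 (- e0); have := g0 e1; have := g0 (- e1); lra.
rewrite {1}(vec_decomp v); apply: le_trans (gaugeD hp _ _) _.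
have := h e0 _ _ (coord_le_norm v 0); have := h e1 _ _ (coord_le_norm v 1).
have := normr_ge0 v; rewrite /C -/e0 -/e1; lra.
Qed.

Lemma gauge_dist x y : p x - p y <= p (x - y).
Proof. by rewrite lerBlDr; have := gaugeD hp (x - y) y; rewrite subrK. Qed.

Lemma continuous_gauge : continuous p.
Proof.
have [C C0 hC] := gauge_le_norm.
move=> x; apply/(@cvgrPdist_le _ _ _ (nbhs x) (nbhs_filter x)) => e e0.
apply/nbhs_planeP; exists (e / C) => [|y /ltW xy]; first exact: divr_gt0.
have := gauge_dist x y; have := gauge_dist y x.
have := hC (x - y); have := hC (y - x); rewrite distrC => h1 h2 h3 h4.
rewrite ler_pdivlMr // mulrC in xy.
by rewrite ler_norml; apply/andP; split; lra.
Qed.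

Lemma continuous_radial : continuous (radial p).
Proof.
have pd : continuous (fun t => p (dir t)).
  move=> t; apply: (@continuous_comp R plane R dir p).
    exact: continuous_dir.
  exact: continuous_gauge.
move=> t; apply: cvgZ; last exact: continuous_dir.
by apply: cvgV; [rewrite gt_eqF // gauge_dir_gt0|exact: pd].
Qed.

(** The form attains its maximum on the unit curve by compactness of the angle interval; homogeneity
    extends the bound to all vectors. *)
Lemma radial_dot_max v : exists t, forall x, dot v x <= p x * dot v (radial p t).
Proof.
have [||t _ ht] := @EVT_max R (fun t => dot v (radial p t)) 0 (pi *+ 2).
- by have := pi_gt0 R; lra.
- apply: continuous_subspaceT => t.
  apply: (@continuous_comp R plane R (radial p) (dot v)).
    exact: continuous_radial.
  exact: continuous_dot.
exists t => x; have [->|x0] := eqVneq x 0.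
  by rewrite (gauge0 hp) mul0r dot0r.
have [s /andP[s0 s2] xE] := radial_surj hp x0.
rewrite {1}xE dotZr ler_wpM2l ?gauge_ge0 //; apply: ht.
by rewrite in_itv /= s0 ltW.
Qed.

Lemma radial_dot_max_ge0 v t : (forall x, dot v x <= p x * dot v (radial p t)) ->
  0 <= dot v (radial p t).
Proof.
move=> h; have [->|v0] := eqVneq v 0; first by rewrite dot0l.
have := h v; have := dot_gt0 v0; have := gauge_gt0 hp v0 => h1 h2 h3.
by rewrite -(pmulr_rge0 _ h1); lra.
Qed.

(** The support function of the unit disk of [p], that is, the dual norm after identifying linear
    forms with vectors through [dot]. *)
Definition dual_gauge y : R := sup (range (fun t => dot y (radial p t))).

Lemma dual_gauge_attained y : exists2 t, dual_gauge y = dot y (radial p t) &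
  forall x, dot y x <= p x * dual_gauge y.
Proof.
have [t ht] := radial_dot_max y; exists t.
  apply/eqP; rewrite eq_le; apply/andP; split.
    apply: sup_le_ub; first by exists (dot y (radial p 0)); exists 0.
    by move=> _ [s _ <-]; have := ht (radial p s); rewrite gauge_radial // mul1r.
  apply: ub_le_sup; last by exists t.
  exists (dot y (radial p t)) => _ [s _ <-].
  by have := ht (radial p s); rewrite gauge_radial // mul1r.
move=> x; apply: le_trans (ht x) _; apply: ler_wpM2l; first exact: gauge_ge0.
apply: ub_le_sup; last by exists t.
exists (dot y (radial p t)) => _ [s _ <-].
by have := ht (radial p s); rewrite gauge_radial // mul1r.
Qed.

Lemma dot_le_dual y x : dot y x <= p x * dual_gauge y.
Proof. by have [t _] := dual_gauge_attained y. Qed.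

Lemma dual_is_gauge : is_gauge dual_gauge.
Proof.
have le y t : dot y (radial p t) <= dual_gauge y.
  by have := dot_le_dual y (radial p t); rewrite gauge_radial // mul1r.
split.
- move=> x y; have [t -> _] := dual_gauge_attained (x + y).
  by rewrite dotDl lerD.
- move=> a x a0; apply/eqP; rewrite eq_le; apply/andP; split.
    have [t -> _] := dual_gauge_attained (a *: x).
    by rewrite dotZl ler_wpM2l.
  have [t -> _] := dual_gauge_attained x.
  by rewrite -dotZl.
- move=> x x0; have := dot_le_dual x x; have := dot_gt0 x0; have := gauge_gt0 hp x0.
  move=> h1 h2 h3; rewrite -(pmulr_rgt0 _ h1); lra.
Qed.

(* One-step Hahn-Banach extension from the line of v. *)
Lemma gauge_support v : exists2 y, dot y v = p v & forall x, dot y x <= p x.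
Proof.
have [->|v0] := eqVneq v 0.
  exists 0 => [|x]; first by rewrite dot0l (gauge0 hp).
  by rewrite dot0l gauge_ge0.
have d0 := dot_gt0 v0; set d := dot v v in d0.
(* [u] is [v] turned by a right angle; the extension is determined by its value at [u]. *)
pose u : plane := \row_i (if i == 0 then - v 0 1 else v 0 0).
pose S := range (fun s => s * p v - p (s *: v - u)).
have key s s' : s * p v - p (s *: v - u) <= p (s' *: v + u) - s' * p v.
  rewrite lerBlDr addrAC lerBrDr -mulrDl.
  apply: le_trans (gaugeD hp _ _); rewrite addrACA subrr addr0 -scalerDl.
  have [h|h] := leP 0 (s + s'); first by rewrite gaugeZ // addrC.
  by apply: le_trans (gauge_ge0 hp _); have := gauge_ge0 hp v; nra.
(* By [key] every lower bound for the value at [u] is below every upper bound, so the supremum of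
   the lower bounds is admissible. *)
pose a := sup S.
have S0 : S !=set0 by exists (0 * p v - p (0 *: v - u)); exists 0.
have ha s : s * p v - p (s *: v - u) <= a.
  apply: ub_le_sup; last by exists s.
  by exists (p (0 *: v + u) - 0 * p v) => _ [s' _ <-]; exact: key.
have ha' s : a <= p (s *: v + u) - s * p v.
  by apply: sup_le_ub => // _ [s' _ <-]; exact: key.
pose y : plane := d^-1 *: (p v *: v + a *: u).
have uv : dot u v = 0 by rewrite /dot !mxE /=; ring.
have vu : dot v u = 0 by rewrite dotC.
have uu : dot u u = d by rewrite /d /dot !mxE /=; ring.
have yv : dot y v = p v.
  by rewrite /y dotZl dotDl !dotZl uv mulr0 addr0 mulrC mulfK // gt_eqF.
have yu : dot y u = a.
  by rewrite /y dotZl dotDl !dotZl vu mulr0 add0r uu mulrC mulfK // gt_eqF.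
exists y => // x.
pose s := dot v x / d; pose t := dot u x / d.
have xE : x = s *: v + t *: u.
  have dd : v 0 0 * v 0 0 + v 0 1 * v 0 1 != 0 by rewrite -/(dot v v) gt_eqF.
  by apply/rowP; apply: ord2P; rewrite /s /t /d /dot !mxE /=; field.
rewrite [in dot y x]xE dotDr !dotZr yv yu.
(* The sign of [t] decides whether the lower or the upper bound on [a] is used, after scaling by the
   absolute value of [t]. *)
have [t0|t0|t0] := ltgtP t 0.
- have := ha (s / - t); rewrite lerBlDr -lerBlDl => h.
  have tN : 0 <= - t by lra.
  have := ler_wpM2l tN h; rewrite -(gaugeZ hp (_ - u) tN).
  have -> : (- t) *: ((s / - t) *: v - u) = x.
    rewrite xE scalerBr scalerA mulrCA divff ?mulr1; last by lra.
    by rewrite scaleNr opprK.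
  rewrite mulrBr mulrA [- t * _]mulrCA divff ?mulr1; lra.
- have := ha' (s / t); rewrite lerBrDr => h.
  have := ler_wpM2l (ltW t0) h; rewrite -(gaugeZ hp (_ + u) (ltW t0)).
  have -> : t *: ((s / t) *: v + u) = x.
    by rewrite xE scalerDr scalerA mulrCA divff ?mulr1 // gt_eqF.
  by rewrite mulrDr mulrA [t * (s / t)]mulrCA divff ?gt_eqF // mulr1; lra.
- rewrite xE t0 mul0r scale0r !addr0; have [s0|s0] := leP 0 s.
    by rewrite gaugeZ.
  by apply: le_trans (gauge_ge0 hp _); have := gauge_ge0 hp v; nra.
Qed.

Hypothesis pN : forall x, p (- x) = p x.

(* The functionals are quarter differences of consecutive dual unit vectors: by
   [radial_variation_le] their absolute values add up to at most [p], with
   equality at v when the supporting functionals of v and - v occur. *)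
Lemma gauge_sum_abs (V : seq plane) : exists n (f : nat -> plane),
  (forall x, \sum_(0 <= i < n) `|dot (f i) x| <= p x) /\
  (forall v, v \in V -> p v <= \sum_(0 <= i < n) `|dot (f i) v|).
Proof.
set q := dual_gauge; have hq : is_gauge q := dual_is_gauge.
(* A form supporting at [v] lies on the dual unit curve, and this is its angle. *)
have exA v : exists t, 0 <= t < pi *+ 2 /\ dot v (radial q t) = p v.
  have [->|v0] := eqVneq v 0.
    exists 0; rewrite lexx (gauge0 hp) dot0l; split => //.
    by have := pi_gt0 R; rewrite /=; lra.
  have [y yv hy] := gauge_support v.
  have [t _ ht] := dual_gauge_attained y; have pv := gauge_gt0 hp v0.
  have q1 : q y = 1.
    have [s qE _] := dual_gauge_attained y.
    apply/eqP; rewrite eq_le; apply/andP; split.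
      by rewrite /q qE; have := hy (radial p s); rewrite gauge_radial.
    by have := ht v; rewrite yv ler_pMr.
  by have [s hs yE] := radial_surj1 hq q1; exists s; split=> //; rewrite -yE dotC.
have {exA} [A hA] := choice exA.
pose L := [seq A v | v <- V ++ [seq - v | v <- V]].
pose s := sort <=%R L; pose n := size s.
have sL : s =i L by move=> x; rewrite mem_sort.
have hs t : t \in s -> 0 <= t < pi *+ 2.
  by rewrite sL => /mapP[v _ ->]; case: (hA v).
pose T := cyclic_nth s.
have [n0|n0] := posnP n.
  exists 0%N, (fun=> 0); split => [x|v vV]; first by rewrite big_nil gauge_ge0.
  suff : A v \in s by rewrite (size0nil n0).
  by rewrite sL map_f // mem_cat vV.
have Tn : T n = T 0%N + pi *+ 2 := cyclic_nth_closed n0.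
have ss : sorted <=%R s by apply: sort_sorted => x y; exact: le_total.
have Tmono i : (i < n)%N -> T i <= T i.+1 := cyclic_nth_homo ss hs (i := i).
(* The variation of [dot x] along the dual curve is at most [2 * (p x + p (- x)) = 4 * p x], hence
   the factor one quarter. *)
pose f i := 4^-1 *: (radial q (T i.+1) - radial q (T i)).
have fE x : \sum_(0 <= i < n) `|dot (f i) x| =
    4^-1 * \sum_(0 <= i < n) `|dot x (radial q (T i.+1)) - dot x (radial q (T i))|.
  rewrite mulr_sumr; apply: eq_bigr => i _.
  by rewrite /f dotZl normrM ger0_norm ?invr_ge0 // dotBl !(dotC x).
have qle x t : dot x (radial q t) <= p x.
  by rewrite dotC; have := dot_le_dual (radial q t) x; rewrite -/q gauge_radial // mulr1.
exists n, f; split => [x|v vV].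
  rewrite fE; have [i [j [_ _ h]]] := radial_variation_le hq x Tmono Tn.
  have := qle x (T i); have := qle (- x) (T j); rewrite pN dotNl; lra.
have [i lin iE] : exists2 i, (i < n)%N & T i = A v.
  have h : A v \in s by rewrite sL map_f // mem_cat vV.
  by exists (index (A v) s); [rewrite index_mem|rewrite /T /cyclic_nth nth_index].
have [j ljn jE] : exists2 j, (j < n)%N & T j = A (- v).
  have h : A (- v) \in s by rewrite sL map_f // mem_cat map_f ?orbT.
  by exists (index (A (- v)) s); [rewrite index_mem|rewrite /T /cyclic_nth nth_index].
(* At these two indices the values are [p v] and [- p v], so the variation is at least [4 * p v]. *)
have := @closed_variation_ge R (fun i => dot v (radial q (T i))) n i j.
rewrite Tn radialD2pi iE jE (hA v).2 => /(_ erefl (ltnW lin) (ltnW ljn)).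
have := (hA (- v)).2; rewrite pN dotNl fE; lra.
Qed.

End GaugeContinuity.

(** * The gauge of a convex disk *)

Section ConvexDisk.
Context {R : realType}.
Local Notation plane := 'rV[R]_2.
Implicit Types (u v w x y z : plane) (a b k t : R).

Lemma convex_setE (A : set plane) :
  convex_set (A : set (convex_lmodType plane)) <->
  forall x y k, 0 <= k -> k <= 1 -> A x -> A y -> A (k *: x + (1 - k) *: y).
Proof.
split=> [h x y k k0 k1 Ax Ay|h x y k].
  have := h x y (Itv01 k0 k1) (mem_set Ax) (mem_set Ay).
  by rewrite inE.
rewrite !inE => Ax Ay; have k0 : 0 <= k%:num by [].
have k1 : k%:num <= 1 by [].
exact: (h x y k%:num k0 k1 Ax Ay).
Qed.

Variables (K : set plane) (o : plane).
Hypotheses (hK : convex_disk K) (Ko : K° o).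

Let p := oval_norm o K.
Let S v := [set t : R | 0 < t /\ K (o + t^-1 *: v)].

Lemma disk_conv x y k : 0 <= k -> k <= 1 -> K x -> K y -> K (k *: x + (1 - k) *: y).
Proof. by case: hK => _ /convex_setE h _; exact: h. Qed.

Let S_up v t t' : S v t -> t <= t' -> S v t'.
Proof.
move=> [t0 Kt] tt'; have t'0 : 0 < t' by exact: lt_le_trans tt'.
split=> //; have -> : o + t'^-1 *: v =
    (t / t') *: (o + t^-1 *: v) + (1 - t / t') *: o.
  apply/rowP => i; rewrite !mxE; field.
  by rewrite !gt_eqF.
apply: disk_conv => //; last exact: nbhs_singleton.
  by rewrite divr_ge0 ?ltW.
by rewrite ler_pdivrMr // mul1r.
Qed.

Let ball_o : exists2 e, 0 < e & forall v, `|v| < e -> K (o + v).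
Proof.
have /nbhs_planeP[e e0 he] : nbhs o K by [].
by exists e => // v ve; apply: he; rewrite opprD addrA subrr add0r normrN.
Qed.

Let S_inh v : S v !=set0.
Proof.
have [e e0 he] := ball_o.
exists ((`|v| + 1) / e); split.
  by rewrite divr_gt0 // ltr_wpDl.
apply: he; rewrite normrZ ger0_norm; last first.
  by rewrite invr_ge0 divr_ge0 ?addr_ge0 // ltW.
by rewrite invf_div -mulrA gtr_pMr // mulrC ltr_pdivrMr ?mul1r ?ltrDl // ltr_wpDl.
Qed.

Let S_bound : exists2 C, 0 < C & forall v t, S v t -> `|v| <= C * t.
Proof.
case: hK => /compact_bounded /ex_strict_bound_gt0[C C0 hC] _ _.
exists (C + `|o|); first by rewrite ltr_wpDr.
move=> v t [t0 /hC /= h].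
have : `|t^-1 *: v| <= C + `|o|.
  have -> : t^-1 *: v = (o + t^-1 *: v) - o by rewrite addrC addKr.
  by apply: le_trans (ler_normB _ _) _; rewrite lerD2r ltW.
have ti : 0 <= t^-1 by rewrite invr_ge0 ltW.
by rewrite normrZ (ger0_norm ti) ler_pdivrMl // [t * _]mulrC.
Qed.

Let S_lb v : has_lbound (S v).
Proof. by exists 0 => t [/ltW]. Qed.

Let p_le v t : S v t -> p v <= t.
Proof. by move=> h; exact: ge_inf (S_lb v) _ h. Qed.

Let p_lt v t : p v < t -> S v t.
Proof.
move=> h; have [s Ss st] := inf_lt (S_inh v) h.
by apply: (S_up Ss); exact: ltW.
Qed.

Lemma norm_le_oval : exists2 C, 0 < C & forall v, `|v| <= C * p v.
Proof.
have [C C0 hC] := S_bound; exists C => // v.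
rewrite mulrC -ler_pdivrMr //; apply: (lb_le_inf (S_inh v)) => t /hC.
by rewrite ler_pdivrMr // mulrC.
Qed.

Lemma disk_closed : closed K.
Proof. by case: hK => + _ _; apply: compact_closed; exact: norm_hausdorff. Qed.

Lemma oval_le1 v : (p v <= 1) <-> K (o + v).
Proof.
split=> [pv|Kv]; last by apply: p_le; split=> //; rewrite invr1 scale1r.
apply: contrapT => nK.
have /nbhs_planeP[e e0 he] : nbhs (o + v) (~` K).
  by apply: open_nbhs_nbhs; split=> //; exact: closed_openC disk_closed.
(* Small enough that [(1 - d) *: v] still leads to a point in the ball around [o + v] that misses
   K. *)
pose d := e / (`|v| + e + 1); have n0 := normr_ge0 v.
have d0 : 0 < d by rewrite divr_gt0 //; lra.
have d1 : d < 1 by rewrite ltr_pdivrMr; lra.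
have dv : d * `|v| < e.
  by rewrite /d mulrAC ltr_pdivrMr; nra.
have /p_lt[_] : p v < (1 - d)^-1.
  by apply: le_lt_trans pv _; rewrite invf_gt1; lra.
rewrite invrK; apply: he.
have -> : o + v - (o + (1 - d) *: v) = d *: v.
  by apply/rowP => i; rewrite !mxE; ring.
by rewrite normrZ ger0_norm ?ltW.
Qed.

Let oval0 : p 0 = 0.
Proof.
apply/eqP; rewrite eq_le; apply/andP; split; last first.
  by apply: (lb_le_inf (S_inh 0)) => t [/ltW].
apply/ler_addgt0Pl => e e0; rewrite addr0; apply: p_le.
by split=> //; rewrite scaler0 addr0; exact: nbhs_singleton.
Qed.

Let ovalZ a v : 0 < a -> p (a *: v) = a * p v.
Proof.
move=> a0; have h b w : 0 < b -> p (b *: w) <= b * p w.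
  move=> b0; apply/ler_addgt0Pl => e e0.
  have /p_lt[t0 ht] : p w < p w + e / b by rewrite ltrDl divr_gt0.
  have -> : e + b * p w = b * (p w + e / b) by field; rewrite gt_eqF.
  apply: p_le; split; first exact: mulr_gt0.
  by rewrite scalerA invfM mulrC mulrA divff ?gt_eqF // mul1r.
apply/eqP; rewrite eq_le h //=.
have := h a^-1 (a *: v); rewrite scalerA mulVf ?gt_eqF // scale1r invr_gt0.
by move=> /(_ a0); rewrite ler_pdivlMl.
Qed.

Let oval_gt0 v : v != 0 -> 0 < p v.
Proof.
move=> v0; have [C C0 hC] := norm_le_oval.
by rewrite -(pmulr_rgt0 _ C0); apply: lt_le_trans (hC v); rewrite normr_gt0.
Qed.

Lemma oval_is_gauge : is_gauge p.
Proof.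
split=> // [x y|a x]; last first.
  by rewrite le_eqVlt => /predU1P[<-|/ovalZ//]; rewrite scale0r oval0 mul0r.
have [->|x0] := eqVneq x 0; first by rewrite add0r oval0 add0r.
have [->|y0] := eqVneq y 0; first by rewrite addr0 oval0 addr0.
have px := oval_gt0 x0; have py := oval_gt0 y0.
have h z : z != 0 -> K (o + (p z)^-1 *: z).
  move=> z0; apply/oval_le1; rewrite ovalZ ?invr_gt0 ?oval_gt0 //.
  by rewrite mulVf ?gt_eqF ?oval_gt0.
(* With weights proportional to [p x] and [p y], the normalized vectors combine to [x + y] divided
   by [p x + p y]; convexity of K then gives the triangle inequality. *)
have k0 : 0 <= p x / (p x + p y) by rewrite divr_ge0 ?ltW ?addr_gt0.
have k1 : p x / (p x + p y) <= 1.
  by rewrite ler_pdivrMr ?addr_gt0 // mul1r lerDl ltW.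
have := disk_conv k0 k1 (h _ x0) (h _ y0).
have -> : (p x / (p x + p y)) *: (o + (p x)^-1 *: x) +
    (1 - p x / (p x + p y)) *: (o + (p y)^-1 *: y) =
    o + (p x + p y)^-1 *: (x + y).
  apply/rowP => i; rewrite !mxE; field.
  by rewrite !gt_eqF ?addr_gt0.
move=> /oval_le1; rewrite ovalZ ?invr_gt0 ?addr_gt0 //.
by rewrite ler_pdivrMl ?addr_gt0 // mulr1.
Qed.

Let hp := oval_is_gauge.

Lemma oval_lt1 v : (p v < 1) <-> K° (o + v).
Proof.
split=> [pv|/nbhs_planeP[e e0 he]].
  have [C C0 hC] := gauge_le_norm hp.
  apply/nbhs_planeP; exists ((1 - p v) / C); first by rewrite divr_gt0 // subr_gt0.
  move=> y hy; have -> : y = o + (y - o) by rewrite addrC subrK.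
  apply/oval_le1; have := gauge_dist hp (y - o) v; have := hC (y - o - v).
  move: hy; rewrite distrC opprD addrA ltr_pdivlMr // mulrC.
  by lra.
have [->|v0] := eqVneq v 0; first by rewrite oval0.
have nv : 0 < `|v| by rewrite normr_gt0.
(* Around an interior point there is room to lengthen [v] by the factor [1 + d] within K, which
   gives [(1 + d) * p v <= 1]. *)
pose d := e / 2 / `|v|; have d0 : 0 < d by rewrite !divr_gt0.
have : K (o + (1 + d) *: v).
  apply: he; have -> : o + v - (o + (1 + d) *: v) = - (d *: v).
    by apply/rowP => i; rewrite !mxE; ring.
  by rewrite normrN normrZ gtr0_norm // divfK ?gt_eqF //; lra.
move=> /oval_le1; rewrite ovalZ; last by lra.
by have := oval_gt0 v0; nra.
Qed.

Lemma boundary_disk x : boundary K x <-> p (x - o) = 1.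
Proof.
have xE : x = o + (x - o) by rewrite addrC subrK.
rewrite /boundary -(closure_id K).1 //; last exact: disk_closed.
split=> [[Kx nK]|px].
  apply/eqP; rewrite eq_le leNgt; apply/andP; split.
    by rewrite -leNgt; apply/oval_le1; rewrite -xE.
  by rewrite leNgt; apply/negP => /oval_lt1; rewrite -xE.
split; first by rewrite xE; apply/oval_le1; rewrite px.
by rewrite xE => /oval_lt1; rewrite -/p px ltxx.
Qed.

End ConvexDisk.

(** * The center and the norm of a symmetric oval *)

Section SymmetricOval.
Context {R : realType}.
Local Notation plane := 'rV[R]_2.
Variables (B : set plane) (c : plane).
Hypothesis hB : symmetric_oval c B.

(** A ball in B around [q] and its reflection in the center have a ball around [c] as their set of
    midpoints. *)
Lemma symmetric_oval_center : B° c.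
Proof.
case: hB => [[_ /convex_setE conv [q Bq]] sym].
have /nbhs_planeP[e e0 he] : nbhs q B by [].
apply/nbhs_planeP; exists e => // y cy.
have -> : y = 2^-1 *: (q + (y - c)) + (1 - 2^-1) *: (c *+ 2 - (q - (y - c))).
  by apply/rowP => i; rewrite !mxE; field.
apply: conv; [lra|lra| |].
  by apply: he; rewrite opprD addrA subrr add0r opprB.
by apply: sym; apply: he; rewrite opprB addrCA subrr addr0 distrC.
Qed.

Lemma symmetric_oval_normN v : oval_norm c B (- v) = oval_norm c B v.
Proof.
rewrite /oval_norm; congr inf; apply/seteqP.
by split=> t /= [t0 /hB.2]; rewrite mulr2n opprD addrA addrK ?scalerN ?opprK.
Qed.

End SymmetricOval.

(** * Length of the boundary curve *)

Section CurveLength.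
Context {R : realType}.
Local Notation plane := 'rV[R]_2.
Implicit Types (v x : plane) (y : nat -> plane) (K : set plane).

Definition polygon_length (p : plane -> R) y n : R :=
  \sum_(0 <= i < n) p (y i.+1 - y i).

Definition radial_param (o : plane) K (t : R) : plane :=
  o + radial (oval_norm o K) (pi *+ 2 * t).

Lemma radial_param_simple_closed o K : convex_disk K -> K° o ->
  simple_closed_parametrization (boundary K) (radial_param o K).
Proof.
move=> hK Ko; have hp := oval_is_gauge hK Ko.
have pi0 : 0 < pi *+ 2 :> R by have := pi_gt0 R; lra.
split.
- apply: continuous_subspaceT => t; apply: cvgD; first exact: cvg_cst.
  apply: (@continuous_comp R R plane (fun t => pi *+ 2 * t) (radial (oval_norm o K))).
    by apply: (@continuousM R R (cst (pi *+ 2)) id); [exact: cst_continuous|exact: cvg_id].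
  exact: continuous_radial.
- by rewrite /radial_param mulr0 mulr1 -(add0r (pi *+ 2)) radialD2pi.
- move=> s t /=; rewrite !in_itv /= => /andP[s0 s1] /andP[t0 t1] /addrI.
  move/(radial_inj hp) => h; apply: (mulfI (lt0r_neq0 pi0)); apply: h.
    by apply/andP; split; [rewrite mulr_ge0 // ltW|rewrite gtr_pMr].
  by apply/andP; split; [rewrite mulr_ge0 // ltW|rewrite gtr_pMr].
- apply/seteqP; split=> [_ [t _ <-]|x /(boundary_disk hK Ko) /(radial_surj1 hp)[t]].
    by apply/(boundary_disk hK Ko); rewrite /radial_param addrC addKr gauge_radial.
  move=> /andP[t0 t1] xE; exists (t / (pi *+ 2)).
    by rewrite /= in_itv /= divr_ge0 ?(ltW pi0) //= ler_pdivrMr // mul1r ltW.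
  by rewrite /radial_param mulrCA divff ?mulr1 ?gt_eqF // -xE addrC subrK.
Qed.

Variables (B : set plane) (c : plane).
Hypothesis hB : symmetric_oval c B.
Let p := oval_norm c B.

Let hp : is_gauge p := oval_is_gauge hB.1 (symmetric_oval_center hB).
Let pN v : p (- v) = p v := symmetric_oval_normN hB v.

(** The last hypothesis says, through linear forms, that the convex hull of the vertices contains K.
    On a polygon inscribed in the boundary each form varies by at most twice a difference of values
    on K, and the closed polygon [y] varies at least as much. *)
Lemma perimeter_le_polygon o K y n : convex_disk K -> K° o -> y n = y 0%N ->
  (forall v x, K x -> exists2 i, (i <= n)%N & dot v x <= dot v (y i)) ->
  (closed_curve_length c B (boundary K) <= (polygon_length p y n)%:E)%E.
Proof.
move=> hK Ko yn hy; have hq := oval_is_gauge hK Ko.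
apply: (@le_trans _ _ (curve_length c B (radial_param o K))).
  by apply: ereal_inf_lbound; exists (radial_param o K) => //; exact: radial_param_simple_closed.
apply: ge_ereal_sup => _ [s hs <-]; rewrite lee_fin.
pose T i := pi *+ 2 * nth 1 (0 :: s) i.
pose q := oval_norm o K; set m := size s.
have dE i j : radial_param o K (nth 1 (0 :: s) i) - radial_param o K (nth 1 (0 :: s) j) =
    radial q (T i) - radial q (T j).
  by rewrite /radial_param opprD addrACA subrr add0r.
apply: (@le_trans _ _ (polygon_length p (fun i => radial q (T i)) m)).
  by apply: ler_sum => i _; rewrite -dE.
rewrite /polygon_length.
(* The sum of forms has to agree with [p] on the edges of the inscribed polygon only; on the edges
   of [y] the bound by [p] suffices. *)
pose V := [seq radial q (T i.+1) - radial q (T i) | i <- iota 0 m].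
have [k [f [fle fge]]] := gauge_sum_abs hp pN V.
apply: (@le_trans _ _ (\sum_(0 <= i < m) \sum_(0 <= j < k)
    `|dot (f j) (radial q (T i.+1) - radial q (T i))|)).
  rewrite !big_nat; apply: ler_sum => i im; apply: fge.
  by apply: map_f; rewrite mem_iota.
apply: (@le_trans _ _ (\sum_(0 <= i < n) \sum_(0 <= j < k)
    `|dot (f j) (y i.+1 - y i)|)); last by apply: ler_sum => i _; exact: fle.
rewrite [leLHS]exchange_big [leRHS]exchange_big /=; apply: ler_sum => j _.
have pi0 : 0 < pi *+ 2 :> R by have := pi_gt0 R; lra.
have [hpath /eqP hlast] := hs.
have T0 : T 0%N = 0 by rewrite /T /= mulr0.
have Tm : T m = T 0%N + pi *+ 2.
  by rewrite T0 add0r /T (itv_partition_nth_size _ hs) mulr1.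
have Tmono i : (i < m)%N -> T i <= T i.+1.
  move=> im; rewrite /T ler_pM2l // ltW //.
  by move/(pathP 1) : hpath; exact.
have [a [b [am bm h]]] := radial_variation_le hq (f j) Tmono Tm.
under eq_bigr do rewrite dotBr.
apply: le_trans h _.
have Kr t : K (o + radial q t) by apply/(oval_le1 hK Ko); rewrite gauge_radial.
have [i1 i1n h1] := hy (f j) _ (Kr (T a)).
have [i2 i2n h2] := hy (- f j) _ (Kr (T b)).
have := @closed_variation_ge R (fun i => dot (f j) (y i)) n i1 i2.
rewrite yn => /(_ erefl i1n i2n) h3.
under [leRHS]eq_bigr do rewrite dotBr.
move: h1 h2; rewrite !dotNl !dotDr -/q; move: h3; lra.
Qed.

(** One partition containing the parameters of all [a j] and [b j] yields a closed inscribed polygon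
    through these points, to which [closed_variation_ge] applies for every form at once. *)
Lemma curve_length_ge C g m (f a b : nat -> plane) :
  simple_closed_parametrization C g ->
  (forall x, \sum_(0 <= j < m) `|dot (f j) x| <= p x) ->
  (forall j, (j < m)%N -> C (a j) /\ C (b j)) ->
  ((\sum_(0 <= j < m) 2 * dot (f j) (a j - b j))%:E <= curve_length c B g)%E.
Proof.
move=> [_ g01 _ gC] fle hab.
have ex z : exists t : R, C z -> 0 <= t <= 1 /\ g t = z.
  have [|nC] := pselect (C z); last by exists 0.
  by rewrite -{1}gC => -[t /=]; rewrite in_itv /= => ht gt; exists t.
have {ex} [P hP] := choice ex.
(* A partition starts at an implicit 0 and must end at 1, so only parameters strictly between are
   sorted, and 1 is appended. *)
pose L := [seq P (a j) | j <- iota 0 m] ++ [seq P (b j) | j <- iota 0 m].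
pose s' := sort <=%R (undup [seq t <- L | 0 < t < 1]); pose s := rcons s' 1.
have s'E t : (t \in s') = (0 < t < 1) && (t \in L).
  by rewrite mem_sort mem_undup mem_filter.
have ss' : sorted <%R s'.
  by rewrite lt_sorted_uniq_le sort_uniq undup_uniq sort_sorted // => x z; exact: le_total.
have hpath : path <%R 0 s.
  rewrite rcons_path path_sortedE; last exact: lt_trans.
  rewrite ss' andbT; apply/andP; split.
    by apply/allP => t; rewrite s'E => /andP[/andP[]].
  have := mem_last 0 s'; rewrite in_cons => /predU1P[->//|].
  by rewrite s'E => /andP[/andP[]].
have hlast : last 0 s = 1 by rewrite last_rcons.
have hs : itv_partition 0 1 s by split=> //; apply/eqP.
apply: (@le_trans _ _ (\sum_(0 <= i < size s)
    p (g (nth 1 (0 :: s) i.+1) - g (nth 1 (0 :: s) i)))%:E); last first.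
  by apply: ereal_sup_ubound; exists s.
rewrite lee_fin; set G := fun i => g (nth 1 (0 :: s) i).
apply: (@le_trans _ _ (\sum_(0 <= i < size s) \sum_(0 <= j < m)
    `|dot (f j) (G i.+1 - G i)|)); last by apply: ler_sum => i _; exact: fle.
rewrite [leRHS]exchange_big /= !big_nat; apply: ler_sum => j /andP[_ jm].
have G_surj z : C z -> P z \in L -> exists2 i, (i <= size s)%N & G i = z.
  move=> Cz PL; have [/andP[Pz0 Pz1] gP] := hP z Cz.
  have [P0|P0] := eqVneq (P z) 0; first by exists 0%N => //; rewrite /G /= -P0.
  have Ps : P z \in s.
    rewrite mem_rcons in_cons s'E PL lt0r P0 Pz0 lt_neqAle Pz1 !andbT /=.
    by case: eqVneq.
  by exists (index (P z) s).+1; rewrite ?index_mem // /G /= nth_index.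
have jI : j \in iota 0 m by rewrite mem_iota.
have [Ca Cb] := hab _ jm.
have [i1 i1n <-] : exists2 i, (i <= size s)%N & G i = a j.
  by apply: G_surj => //; rewrite mem_cat (map_f (fun j => P (a j))).
have [i2 i2n <-] : exists2 i, (i <= size s)%N & G i = b j.
  by apply: G_surj => //; rewrite mem_cat (map_f (fun j => P (b j))) ?orbT.
have := @closed_variation_ge R (fun i => dot (f j) (G i)) (size s) i1 i2.
have -> : G (size s) = G 0%N by rewrite /G (itv_partition_nth_size _ hs) /= g01.
move=> /(_ erefl i1n i2n) h; rewrite dotBr; apply: le_trans h _.
by apply: ler_sum => i _; rewrite dotBr.
Qed.

Lemma perimeter_ge C m (f a b : nat -> plane) :
  (forall x, \sum_(0 <= j < m) `|dot (f j) x| <= p x) ->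
  (forall j, (j < m)%N -> C (a j) /\ C (b j)) ->
  ((\sum_(0 <= j < m) 2 * dot (f j) (a j - b j))%:E <= closed_curve_length c B C)%E.
Proof.
move=> fle hab; apply: le_ereal_inf_tmp => _ [g hg <-].
exact: curve_length_ge hg fle hab.
Qed.

End CurveLength.

(** * Touching copies as separated points of the parallel curve *)

Section Touching.
Context {R : realType}.
Local Notation plane := 'rV[R]_2.
Implicit Types (u v w x : plane).

Variables (B F : set plane) (c : plane) (lambda : R).
Hypotheses (hB : symmetric_oval c B) (hF : convex_disk F) (lambda_gt0 : 0 < lambda).
Let p := oval_norm c B.

Let hp : is_gauge p := oval_is_gauge hB.1 (symmetric_oval_center hB).

Let lambdaV_ge0 : 0 <= lambda^-1. Proof. by rewrite invr_ge0 ltW. Qed.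

Lemma oval_normN v : p (- v) = p v.
Proof. exact: symmetric_oval_normN. Qed.

Lemma oval_normC u v : p (u - v) = p (v - u).
Proof. by rewrite -oval_normN opprB. Qed.

Lemma oval_norm_triangle u v w : p (u - w) <= p (u - v) + p (v - w).
Proof.
have -> : u - w = (u - v) + (v - w) by rewrite addrA subrK.
exact: gaugeD.
Qed.

Definition oval_ball u : set plane := [set x | p (x - u) <= lambda].

Lemma homothetic_copyP X : homothetic_copy B lambda X <-> exists u, X = oval_ball u.
Proof.
have E v : [set v + lambda *: b | b in B] = oval_ball (v + lambda *: c).
  apply/seteqP; split=> [_ [b Bb <-]|x] /=.
    rewrite /oval_ball /=.
    have -> : v + lambda *: b - (v + lambda *: c) = lambda *: (b - c).
      by apply/rowP => i; rewrite !mxE; ring.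
    rewrite (gaugeZ hp _ (ltW lambda_gt0)) ger_pMr //.
    by apply/(oval_le1 hB.1 (symmetric_oval_center hB)); rewrite addrC subrK.
  rewrite /oval_ball /= => h; exists (c + lambda^-1 *: (x - (v + lambda *: c))).
    apply/(oval_le1 hB.1 (symmetric_oval_center hB)).
    by rewrite -/p (gaugeZ hp _ lambdaV_ge0) ler_pdivrMl // mulr1.
  by apply/rowP => i; rewrite !mxE; field; rewrite gt_eqF.
split=> [[v ->]|[u ->]]; first by exists (v + lambda *: c); exact: E.
by exists (u - lambda *: c); rewrite E subrK.
Qed.

Lemma interior_segment (A : set plane) x v : A° x ->
  exists d : R, [/\ 0 < d, d < 1 & A (x + d *: v)].
Proof.
move=> /nbhs_planeP[e e0 he]; have n0 := normr_ge0 v.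
exists (e / (`|v| + e + 1)); have D0 : 0 < `|v| + e + 1 by lra.
split; first exact: divr_gt0.
  by rewrite ltr_pdivrMr // mul1r; lra.
apply: he; rewrite opprD addrA subrr add0r normrN normrZ ger0_norm ?divr_ge0 ?ltW //.
by rewrite mulrAC ltr_pdivrMr // ltr_pM2l //; lra.
Qed.

Lemma interior_oval_ball u x : (oval_ball u)° x <-> p (x - u) < lambda.
Proof.
split=> [/(interior_segment (x - u))[d [d0 d1]]|h].
  rewrite /oval_ball /=.
  have -> : x + d *: (x - u) - u = (1 + d) *: (x - u).
    by apply/rowP => i; rewrite !mxE; ring.
  rewrite (gaugeZ hp); last by lra.
  move=> h; rewrite ltNge; apply/negP => h2.
  by have := ler_wpM2l (ltW d0) h2; have := mulr_gt0 d0 lambda_gt0; lra.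
have [C C0 hC] := gauge_le_norm hp.
apply/nbhs_planeP; exists ((lambda - p (x - u)) / C).
  by rewrite divr_gt0 // subr_gt0.
move=> y; rewrite ltr_pdivlMr // mulrC distrC => hy.
rewrite /oval_ball /=; have := hC (y - x); have := oval_norm_triangle y x u; lra.
Qed.

(** The touching condition in terms of the centre alone: its distance to F is exactly [lambda]. *)
Definition touches u : Prop :=
  (exists2 f, F f & p (f - u) <= lambda) /\ forall f, F f -> lambda <= p (f - u).

(** A small step from [f] towards [u] stays in F and brings the distance below [lambda]. *)
Lemma interior_not_touching u f : F° f -> p (f - u) <= lambda -> ~ touches u.
Proof.
move=> Ff fu [_ hu]; have [d [d0 d1 Fd]] := interior_segment (u - f) Ff.
have := hu _ Fd.
have -> : f + d *: (u - f) - u = (1 - d) *: (f - u).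
  by apply/rowP => i; rewrite !mxE; ring.
rewrite (gaugeZ hp); last by lra.
have d1' : 0 <= 1 - d by lra.
by have := ler_wpM2l d1' fu; have := mulr_gt0 d0 lambda_gt0; lra.
Qed.

Lemma touching_familyP u : touching_family F B lambda (oval_ball u) <-> touches u.
Proof.
split=> [[_ [f [uf Ff]] hs]|hu].
  split; first by exists f.
  move=> g Fg; rewrite leNgt; apply/negP => h.
  have [|[_ nI] _] := hs g; first by split=> //; exact: ltW.
  by apply: nI; apply/interior_oval_ball.
split; first by apply/homothetic_copyP; exists u.
- by case: hu => -[f Ff uf] _; exists f.
- move=> f [uf Ff]; split; split.
  + exact: subset_closure.
  + by move/interior_oval_ball; rewrite ltNge => /negP; apply; exact: hu.2.
  + exact: subset_closure.
  + by move=> Fi; exact: interior_not_touching Fi uf hu.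
Qed.

Lemma touching_packingP k : touching_packing F B lambda k <->
  exists u : 'I_k -> plane, (forall i, touches (u i)) /\
    forall i j, i != j -> 2 * lambda <= p (u i - u j).
Proof.
split=> [[X [_ hX tX]]|[u [hu su]]].
  have /choice[u uX] i : exists u, X i = oval_ball u.
    by case: (hX i) => /homothetic_copyP.
  exists u; split=> [i|i j ij]; first by apply/touching_familyP; rewrite -uX.
  rewrite leNgt; apply/negP => h.
  have : (X i)° `&` (X j)° !=set0.
    (* The midpoint of two centres closer than [2 * lambda] is interior to both copies. *)
    exists (2^-1 *: (u i + u j)); rewrite !uX; split; apply/interior_oval_ball.
      have -> : 2^-1 *: (u i + u j) - u i = 2^-1 *: - (u i - u j).
        by apply/rowP => l; rewrite !mxE; field.
      by rewrite (gaugeZ hp) // oval_normN; lra.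
    have -> : 2^-1 *: (u i + u j) - u j = 2^-1 *: (u i - u j).
      by apply/rowP => l; rewrite !mxE; field.
    by rewrite (gaugeZ hp) //; lra.
  by move=> /(tX i j Logic.I Logic.I) /eqP; rewrite (negPf ij).
have tr : trivIset setT (fun i => (oval_ball (u i))°).
  apply/trivIsetP => i j _ _ ij; apply/seteqP; split=> // x [].
  move=> /interior_oval_ball h1 /interior_oval_ball h2.
  have := oval_norm_triangle (u i) x (u j); rewrite (oval_normC (u i) x).
  by have := su _ _ ij; lra.
exists (fun i => oval_ball (u i)); split=> // [i j E|i]; last exact/touching_familyP.
(* Equal copies share the interior point [u i], so disjointness of the interiors yields
   injectivity. *)
apply: (tr i j Logic.I Logic.I); exists (u i); split; rewrite -?E.
all: by apply/interior_oval_ball; rewrite subrr (gauge0 hp).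
Qed.

Definition parallel_body : set plane :=
  [set x | exists2 f, F f & p (x - f) <= lambda].

Lemma parallel_body_disk : convex_disk parallel_body.
Proof.
have cB := symmetric_oval_center hB.
case: (hF) => [Fc /convex_setE Fconv [q Fq]].
split.
(* Compactness follows by writing the body as a continuous image of [F] times [B]. *)
- have -> : parallel_body =
      (fun z : plane * plane => z.1 + lambda *: (z.2 - c)) @` (F `*` B).
    apply/seteqP; split=> [x [f Ff xf]|_ [[f b] /= [Ff Bb] <-]].
      exists (f, c + lambda^-1 *: (x - f)) => /=.
        split=> //=; apply/(oval_le1 hB.1 cB).
        by rewrite -/p (gaugeZ hp _ lambdaV_ge0) ler_pdivrMl // mulr1.
      by apply/rowP => i; rewrite !mxE; field; rewrite gt_eqF.
    exists f => //; rewrite addrC addKr (gaugeZ hp _ (ltW lambda_gt0)) ger_pMr //.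
    by apply/(oval_le1 hB.1 cB); rewrite addrC subrK.
  apply: continuous_compact; last by apply: compact_setX => //; case: hB => -[].
  apply: continuous_subspaceT => z.
  apply: cvgD; first exact: cvg_fst.
  apply: cvgZ; first exact: cvg_cst.
  by apply: cvgB; [exact: cvg_snd|exact: cvg_cst].
- apply/convex_setE => x y k k0 k1 [f Ff xf] [g Fg yg].
  exists (k *: f + (1 - k) *: g); first exact: Fconv.
  have -> : k *: x + (1 - k) *: y - (k *: f + (1 - k) *: g) =
      k *: (x - f) + (1 - k) *: (y - g).
    by apply/rowP => i; rewrite !mxE; ring.
  apply: le_trans (gaugeD hp _ _) _; rewrite !(gaugeZ hp) ?subr_ge0 //.
  have : (1 - k) * p (y - g) <= (1 - k) * lambda by rewrite ler_wpM2l ?subr_ge0.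
  have : k * p (x - f) <= k * lambda by rewrite ler_wpM2l.
  lra.
- exists q; move: q Fq; apply: interiorS => f Ff.
  by exists f => //; rewrite subrr (gauge0 hp) ltW.
Qed.

Variable o : plane.
Hypothesis Fo : F° o.

Lemma parallel_body_center : parallel_body° o.
Proof.
by apply: interiorS Fo => f Ff; exists f => //; rewrite subrr (gauge0 hp) ltW.
Qed.

Let q := oval_norm o parallel_body.
Let hq : is_gauge q := oval_is_gauge parallel_body_disk parallel_body_center.

(** A point of F closer than [lambda] would put a whole neighbourhood of this boundary point into
    the parallel body. *)
Lemma touches_radial t : touches (o + radial q t).
Proof.
have Gd := parallel_body_disk; have Go := parallel_body_center.
have q1 := gauge_radial hq t; set v := radial q t in q1 *.
have [f Ff fv] : parallel_body (o + v) by apply/(oval_le1 Gd Go); rewrite -/q q1.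
split; first by exists f => //; rewrite oval_normC.
move=> g Fg; rewrite leNgt; apply/negP => h.
suff : parallel_body° (o + v) by move/(oval_lt1 Gd Go); rewrite -/q q1 ltxx.
have : (oval_ball g)° (o + v) by apply/interior_oval_ball; rewrite oval_normC.
by apply: interiorS => x xg; exists g.
Qed.

(** If [u] were interior to the parallel body, a point slightly further from [o] would still be
    within [lambda] of some [g] in F; contracting both towards [o] gives a point of F closer to [u]
    than [lambda]. *)
Lemma touches_gauge u : touches u -> q (u - o) = 1.
Proof.
move=> [[f Ff fu] hu].
apply/eqP; rewrite eq_le; apply/andP; split.
  apply/(oval_le1 parallel_body_disk parallel_body_center).
  by exists f => //; rewrite (addrC o) subrK oval_normC.
rewrite leNgt; apply/negP => h.
have Gu : parallel_body° u.
  have -> : u = o + (u - o) by rewrite addrC subrK.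
  exact/(oval_lt1 parallel_body_disk parallel_body_center).
have [d [d0 d1 [g Fg ug]]] := interior_segment (u - o) Gu.
have Fz : F ((1 + d)^-1 *: g + (1 - (1 + d)^-1) *: o).
  apply: (disk_conv hF) => //; last exact: nbhs_singleton.
    by rewrite invr_ge0; lra.
  by rewrite invf_le1; lra.
have := hu _ Fz.
have -> : (1 + d)^-1 *: g + (1 - (1 + d)^-1) *: o - u =
    - ((1 + d)^-1 *: (u + d *: (u - o) - g)).
  by apply/rowP => i; rewrite !mxE; field; lra.
rewrite oval_normN (gaugeZ hp); last by rewrite invr_ge0; lra.
rewrite ler_pdivlMl; last by lra.
by have := mulr_gt0 d0 lambda_gt0; lra.
Qed.

Lemma touches_dist_center u : touches u -> lambda < p (u - o).
Proof.
move=> hu; rewrite ltNge; apply/negP; rewrite oval_normC => h.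
exact: interior_not_touching Fo h hu.
Qed.

(* A chord of length at most [2 lambda] lies in the union of the two touching
   balls, hence misses the interior of F. *)
Lemma short_chord_misses_interior u v (s : R) : touches u -> touches v ->
  p (v - u) <= 2 * lambda -> 0 <= s <= 1 ->
  1 <= oval_norm o F ((1 - s) *: u + s *: v - o).
Proof.
move=> hu hv uv /andP[s0 s1]; rewrite leNgt; apply/negP => /(oval_lt1 hF Fo).
rewrite (addrC o) subrK => Fz.
have [s2|s2] := leP s 2^-1.
  apply: interior_not_touching Fz _ hu.
  have -> : (1 - s) *: u + s *: v - u = s *: (v - u).
    by apply/rowP => i; rewrite !mxE; ring.
  by rewrite (gaugeZ hp) //; have := gauge_ge0 hp (v - u); nra.
apply: interior_not_touching Fz _ hv.
have -> : (1 - s) *: u + s *: v - v = (1 - s) *: (- (v - u)).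
  by apply/rowP => i; rewrite !mxE; ring.
by rewrite (gaugeZ hp) ?subr_ge0 // oval_normN; have := gauge_ge0 hp (v - u); nra.
Qed.

End Touching.

(** * The upper bound *)

Section UpperBound.
Context {R : realType}.
Local Notation plane := 'rV[R]_2.

Lemma disk_support_point (K : set plane) : convex_disk K -> forall v : plane,
  exists a, boundary K a /\ forall x, K x -> dot v x <= dot v a.
Proof.
move=> hK v; have [z Kz] : K° !=set0 by case: hK.
have hg := oval_is_gauge hK Kz; have [t ht] := radial_dot_max hg v.
exists (z + radial (oval_norm z K) t); split.
  by apply/(boundary_disk hK Kz); rewrite addrC addKr gauge_radial.
move=> x Kx; have M0 := radial_dot_max_ge0 hg ht.
have gx : oval_norm z K (x - z) <= 1.
  by apply/(oval_le1 hK Kz); rewrite addrC subrK.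
have := ht (x - z); rewrite dotBr dotDr.
by have := ler_wpM2r M0 gx; lra.
Qed.

Variables (B F : set plane) (c : plane) (lambda : R).
Hypotheses (hB : symmetric_oval c B) (hF : convex_disk F) (lambda_gt0 : 0 < lambda).
Let p := oval_norm c B.

Let hp : is_gauge p := oval_is_gauge hB.1 (symmetric_oval_center hB).

Lemma perimeter_lty K : convex_disk K -> (closed_curve_length c B (boundary K) < +oo)%E.
Proof.
move=> hK; have [z Kz] : K° !=set0 by case: hK.
have [C C0 hC] : exists2 C : R, 0 < C & forall x, K x -> `|x| < C.
  by case: hK => /compact_bounded /ex_strict_bound_gt0[C C0 hC] _ _; exists C.
(* The vertices, the first one repeated, of a square that contains K. *)
pose y (i : nat) : plane := \row_(j < 2)
  (if j == 0 then (if i \in [:: 1; 2]%N then - C else C)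
   else (if i \in [:: 2; 3]%N then - C else C)).
apply: le_lt_trans (@perimeter_le_polygon _ _ _ hB z K y 4 hK Kz _ _) (ltry _).
  by apply/rowP => j; rewrite !mxE.
move=> v x Kx.
have := coord_le_norm x 0; have := coord_le_norm x 1; have := hC x Kx.
rewrite !ler_norml => h /andP[h3 h4] /andP[h1 h2].
have e0 i : (i <= 4)%N -> dot v (y i) =
  v 0 0 * (if i \in [:: 1; 2]%N then - C else C) +
  v 0 1 * (if i \in [:: 2; 3]%N then - C else C).
  by rewrite /dot !mxE.
have [v0|v0] := leP 0 (v 0 0); have [v1|v1] := leP 0 (v 0 1).
- by exists 0%N => //; rewrite e0 // /dot /=; nra.
- by exists 3%N => //; rewrite e0 // /dot /=; nra.
- by exists 1%N => //; rewrite e0 // /dot /=; nra.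
- by exists 2%N => //; rewrite e0 // /dot /=; nra.
Qed.

Variable o : plane.
Hypothesis Fo : F° o.
Let G := parallel_body B F c lambda.
Let q := oval_norm o G.

Let hG : convex_disk G := parallel_body_disk hB hF lambda_gt0.
Let Go : G° o := parallel_body_center hB lambda_gt0 Fo.
Let hq : is_gauge q := oval_is_gauge hG Go.

(** The two points lie on opposite rays from [o], each further than [lambda] from it, and along a
    line the distances add. *)
Lemma antipodal_dist t : 2 * lambda < p (radial q (t + pi) - radial q t).
Proof.
have h s : lambda < p (radial q s).
  have := touches_dist_center hB lambda_gt0 Fo (touches_radial hB hF lambda_gt0 Fo s).
  by rewrite addrC addKr.
rewrite (gauge_radial_antipodal t hp (oval_normN hB) hq).
by have := ltrD (h (t + pi)) (h t); rewrite -[lambda + lambda]mulr2n mulr_natl.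
Qed.

Lemma touching_packing2 : touching_packing F B lambda 2.
Proof.
apply/(touching_packingP F hB lambda_gt0).
exists (fun i => o + radial q (if i == 0 then 0 else pi)); split.
  by move=> i; exact: touches_radial.
have h := antipodal_dist 0; rewrite add0r in h.
move=> i j ij; rewrite opprD addrACA subrr add0r.
case: (eqVneq i 0) => i0; case: (eqVneq j 0) => j0.
- by rewrite i0 j0 eqxx in ij.
- by rewrite (oval_normC hB) ltW.
- exact: ltW.
- case/negP: ij; move: i0 j0 (ltn_ord i) (ltn_ord j); rewrite -!val_eqE /=.
  by move: (nat_of_ord i) (nat_of_ord j) => [|[|?]] [|[|?]].
Qed.

(** The centres, sorted by angle about [o], span a closed polygon with edges of length at least
    [2 * lambda]; two centres are required so that the closing edge joins distinct points. Each form
    varies along it by at most twice the width of [G], which splits into the widths of [F] and of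
    [lambda] times [B]. *)
Lemma touching_packing_le2 k : (2 <= k)%N -> touching_packing F B lambda k ->
  ((2 * lambda * k%:R)%:E <= closed_curve_length c B (boundary F)
              + lambda%:E * closed_curve_length c B (boundary B))%E.
Proof.
move=> k2 /(touching_packingP F hB lambda_gt0)[u [hu su]].
have exA i : exists t : R, 0 <= t < pi *+ 2 /\ u i = o + radial q t.
  have [t ht E] := radial_surj1 hq (touches_gauge hB hF lambda_gt0 Fo (hu i)).
  by exists t; split=> //; rewrite -E addrC subrK.
have {exA} [A hA] := choice exA.
pose s := sort <=%R [seq A i | i <- enum 'I_k].
have sz : size s = k by rewrite size_sort size_map size_enum_ord.
have sE t : (t \in s) = (t \in [seq A i | i <- enum 'I_k]) by rewrite mem_sort.
have hs t : t \in s -> 0 <= t < pi *+ 2.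
  by rewrite sE => /mapP[i _ ->]; case: (hA i).
have A_inj : injective A.
  move=> i j E; apply/eqP/negPn/negP => /su.
  by rewrite (hA i).2 (hA j).2 E subrr -/p (gauge0 hp) leNgt mulr_gt0.
have su' : uniq s by rewrite sort_uniq map_inj_uniq ?enum_uniq.
have ss : sorted <=%R s by apply: sort_sorted => x y; exact: le_total.
have sep x y : x \in s -> y \in s -> x != y -> 2 * lambda <= p (radial q x - radial q y).
  rewrite !sE => /mapP[i _ ->] /mapP[j _ ->] ij.
  have /su : i != j by apply: contra ij => /eqP->.
  by rewrite (hA i).2 (hA j).2 opprD addrACA subrr add0r.
have s0 : (0 < size s)%N by rewrite sz; lia.
pose T := cyclic_nth s.
have Tmono i : (i < k)%N -> T i <= T i.+1.
  by move=> ik; apply: cyclic_nth_homo => //; rewrite sz.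
have Tn : T k = T 0%N + pi *+ 2 by rewrite -sz; exact: cyclic_nth_closed.
have Ts i : (i < k)%N -> T i \in s by move=> ik; rewrite mem_nth ?sz.
have Tneq i j : (i < k)%N -> (j < k)%N -> i != j -> T i != T j.
  by move=> ik jk ij; rewrite /T /cyclic_nth nth_uniq ?sz.
pose y i := radial q (T i).
have len : 2 * lambda * k%:R <= polygon_length p y k.
  rewrite /polygon_length big_nat.
  have -> : 2 * lambda * k%:R = \sum_(0 <= i < k | (0 <= i < k)%N) 2 * lambda.
    by rewrite -big_nat sumr_const_nat subn0 mulr_natr.
  apply: ler_sum => i /andP[_ ik]; have [ik'|ik'] := ltnP i.+1 k.
    by apply: sep; rewrite ?Ts // Tneq //; lia.
  have iE : i.+1 = k by lia.
  rewrite /y iE Tn radialD2pi; apply: sep; rewrite ?Ts ?Tneq //; lia.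
have pN v : p (- v) = p v := symmetric_oval_normN hB v.
pose V := [seq y i.+1 - y i | i <- iota 0 k].
have [m [f [fle fge]]] := gauge_sum_abs hp pN V.
have [aF haF] := choice (disk_support_point hF).
have [aB haB] := choice (disk_support_point hB.1).
(* Additivity of support functions for [G = F + lambda (B - c)], in the direction needed. *)
have GE v x : G x -> dot v x <= dot v (aF v) + lambda * dot v (aB v - c).
  move=> [g Fg xg].
  have Bb : B (c + lambda^-1 *: (x - g)).
    apply/(oval_le1 hB.1 (symmetric_oval_center hB)).
    by rewrite -/p (gaugeZ hp) ?invr_ge0 ?(ltW lambda_gt0) // ler_pdivrMl // mulr1.
  have := (haF v).2 _ Fg; have := (haB v).2 _ Bb.
  rewrite dotDr dotZr -lerBrDl -dotBr ler_pdivrMl // (dotBr v x).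
  by clear sz; lra.
have key j : \sum_(0 <= i < k) `|dot (f j) (y i.+1 - y i)| <=
    2 * dot (f j) (aF (f j) - aF (- f j)) +
    lambda * (2 * dot (f j) (aB (f j) - aB (- f j))).
  have [a [b [_ _ h]]] := radial_variation_le hq (f j) Tmono Tn.
  apply: le_trans (le_trans h _).
    by apply: ler_sum => i _; rewrite dotBr.
  have Gr t : G (o + radial q t) by apply/(oval_le1 hG Go); rewrite gauge_radial.
  have := GE (f j) _ (Gr (T a)); have := GE (- f j) _ (Gr (T b)).
  by rewrite !dotNl !dotDr !dotNr; clear sz; lra.
pose SF := \sum_(0 <= j < m) 2 * dot (f j) (aF (f j) - aF (- f j)).
pose SB := \sum_(0 <= j < m) 2 * dot (f j) (aB (f j) - aB (- f j)).
have hS : 2 * lambda * k%:R <= SF + lambda * SB.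
  apply: le_trans len _.
  apply: (@le_trans _ _ (\sum_(0 <= i < k) \sum_(0 <= j < m)
      `|dot (f j) (y i.+1 - y i)|)).
    rewrite /polygon_length !big_nat; apply: ler_sum => i ik; apply: fge.
    by apply: (map_f (fun i => y i.+1 - y i)); rewrite mem_iota.
  rewrite exchange_big /= /SF /SB mulr_sumr -big_split /=.
  by apply: ler_sum => j _.
apply: (@le_trans _ _ (SF + lambda * SB)%:E); first by rewrite lee_fin.
rewrite EFinD EFinM; apply: leeD.
  apply: (@perimeter_ge _ _ _ _ m f (fun j => aF (f j)) (fun j => aF (- f j))) => // j _.
  by split; [case: (haF (f j))|case: (haF (- f j))].
apply: lee_wpmul2l; first by rewrite lee_fin ltW.
apply: (@perimeter_ge _ _ _ _ m f (fun j => aB (f j)) (fun j => aB (- f j))) => // j _.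
by split; [case: (haB (f j))|case: (haB (- f j))].
Qed.

(** For fewer than two copies the bound follows from the one for the antipodal pair. *)
Lemma touching_packing_le k : touching_packing F B lambda k ->
  ((2 * lambda * k%:R)%:E <= closed_curve_length c B (boundary F)
              + lambda%:E * closed_curve_length c B (boundary B))%E.
Proof.
have [k2|k2] := leqP 2 k; first exact: touching_packing_le2.
move=> _; apply: le_trans (touching_packing_le2 (leqnn 2) touching_packing2).
by rewrite lee_fin ler_pM2l ?ler_nat ?mulr_gt0 // ltnW.
Qed.

Lemma touching_packing_bounded : exists M, forall k, touching_packing F B lambda k ->
  (k <= M)%N.
Proof.
have := perimeter_lty hF; have := perimeter_lty hB.1.
have := @touching_packing_le.
(* Both perimeters are real: the enclosing square excludes [+oo], and the bound for two copies
   excludes [-oo]. *)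
case: (closed_curve_length c B (boundary F)) => [x| |] //; last first.
  by move=> /(_ _ touching_packing2); rewrite addNye.
case: (closed_curve_length c B (boundary B)) => [y| |] //; last first.
  move=> /(_ _ touching_packing2).
  by rewrite gt0_muleNy ?lte_fin ?addeNy.
move=> h _ _; pose z := (x + lambda * y) / (2 * lambda).
have l2 : 0 < 2 * lambda by rewrite mulr_gt0.
exists (Num.truncn z); move=> k /h; rewrite -EFinM -EFinD lee_fin => hk.
have kz : k%:R <= z by rewrite ler_pdivlMr // mulrC.
by rewrite truncn_ge_nat // (le_trans _ kz).
Qed.

End UpperBound.

(** * Chords and rays *)

Section Chords.
Context {R : realType}.
Local Notation plane := 'rV[R]_2.
Implicit Types (v x : plane) (a b c d t : R).

Lemma polar_from a v : v != 0 ->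
  exists t r, [/\ a <= t, t < a + pi *+ 2, 0 < r & v = r *: dir t].
Proof.
move=> v0.
(* [w] is [v] turned by the angle [- a]. *)
pose w : plane := \row_i (if i == 0 then cos a * v 0 0 + sin a * v 0 1
  else cos a * v 0 1 - sin a * v 0 0).
have E0 : v 0 0 = cos a * w 0 0 - sin a * w 0 1.
  by rewrite !mxE /= -[LHS]mul1r -(cos2Dsin2 a); ring.
have E1 : v 0 1 = sin a * w 0 0 + cos a * w 0 1.
  by rewrite !mxE /= -[LHS]mul1r -(cos2Dsin2 a); ring.
have w0 : w != 0.
  apply: contra v0 => /eqP w0; apply/eqP/rowP; apply: ord2P.
    by rewrite E0 w0 !mxE; ring.
  by rewrite E1 w0 !mxE; ring.
have [t [r [t0 t2 r0 wE]]] := polar w0.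
exists (a + t), r; split=> //; [by rewrite lerDl|by rewrite ltrD2l|].
by apply/rowP; apply: ord2P; rewrite ?E0 ?E1 wE !mxE /= ?cosD ?sinD; ring.
Qed.

(** The linear form with values [ra] and [rc] at [dir a] and [dir c], evaluated at [dir b]. Its
    reciprocal is the distance from the origin, at angle [b], of the chord between the points at
    distances [ra^-1] and [rc^-1]. *)
Definition chord_gauge a c (ra rc : R) b : R :=
  (sin (c - b) * ra + sin (b - a) * rc) / sin (c - a).

Lemma chord_ray a b c (ra rc : R) : 0 < ra -> 0 < rc ->
  a <= b -> b <= c -> a < c -> c < a + pi ->
  0 < chord_gauge a c ra rc b /\ exists2 s, 0 <= s <= 1 &
    (chord_gauge a c ra rc b)^-1 *: dir b =
    (1 - s) *: (ra^-1 *: dir a) + s *: (rc^-1 *: dir c).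
Proof.
move=> ra0 rc0 ab bc ac ca.
have S0 : 0 < sin (c - a) by apply: sin_gt0_pi; lra.
have S1 : 0 <= sin (c - b) by apply: sin_ge0_pi; lra.
have S2 : 0 <= sin (b - a) by apply: sin_ge0_pi; lra.
have D0 : 0 < sin (c - b) * ra + sin (b - a) * rc.
  have [ab'|ab'] := eqVneq a b.
    by rewrite -ab' subrr sin0 mul0r addr0 mulr_gt0.
  have ab2 : a < b by rewrite lt_neqAle ab'.
  have S2' : 0 < sin (b - a) by apply: sin_gt0_pi; lra.
  by rewrite ltr_wpDl ?mulr_ge0 ?mulr_gt0 // ltW.
split; first by rewrite divr_gt0.
pose D := sin (c - b) * ra + sin (b - a) * rc; rewrite -/D in D0.
exists (sin (b - a) * rc / D).
  apply/andP; split; first by rewrite divr_ge0 ?mulr_ge0 // ltW.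
  by rewrite ler_pdivrMr // mul1r /D lerDr mulr_ge0 // ltW.
rewrite /chord_gauge -/D invf_div [sin _ / D]mulrC -scalerA dir_between scalerDr !scalerA.
congr (_ *: _ + _ *: _).
  have -> : 1 - sin (b - a) * rc / D = sin (c - b) * ra / D.
    by rewrite -[X in X - _](divff (lt0r_neq0 D0)) -mulrBl /D addrK.
  by field; rewrite !lt0r_neq0.
by field; rewrite !lt0r_neq0.
Qed.

Lemma continuous_chord_gauge a c (ra rc : R) : continuous (chord_gauge a c ra rc).
Proof.
have h k : continuous (fun t : R => sin (k - t)).
  move=> t; apply: (@continuous_comp R R R (fun t => k - t) sin).
    by apply: continuousB; [exact: cst_continuous|exact: cvg_id].
  exact: continuous_sin.
have h' k : continuous (fun t : R => sin (t - k)).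
  move=> t; apply: (@continuous_comp R R R (fun t => t - k) sin).
    by apply: continuousB; [exact: cvg_id|exact: cst_continuous].
  exact: continuous_sin.
move=> t; apply: (@continuousM R R (fun t => sin (c - t) * ra + sin (t - a) * rc)
  (cst (sin (c - a))^-1)); last exact: cst_continuous.
apply: (@continuousD R R R (fun t => sin (c - t) * ra) (fun t => sin (t - a) * rc)).
  by apply: (@continuousM R R (fun t => sin (c - t)) (cst ra));
    [exact: h|exact: cst_continuous].
by apply: (@continuousM R R (fun t => sin (t - a)) (cst rc));
  [exact: h'|exact: cst_continuous].
Qed.

(** Chords stay inside the unit disk. At angle [b] the second chord starts on the curve, so the
    first is no further out; at angle [c] the roles are exchanged. The intermediate value theorem
    gives a common point. *)
Lemma chords_cross (q : plane -> R) a b c d : is_gauge q ->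
  a < b -> b <= c -> c < d -> c < a + pi -> d < b + pi ->
  exists t r s s', [/\ b <= t <= c, 0 < r, 0 <= s <= 1, 0 <= s' <= 1 &
    r *: dir t = (1 - s) *: radial q a + s *: radial q c /\
    r *: dir t = (1 - s') *: radial q b + s' *: radial q d].
Proof.
move=> hq ab bc cd ca db; have g0 t := gauge_dir_gt0 hq t.
pose g1 := chord_gauge a c (q (dir a)) (q (dir c)).
pose g2 := chord_gauge b d (q (dir b)) (q (dir d)).
have Sac : 0 < sin (c - a) by apply: sin_gt0_pi; lra.
have Sbd : 0 < sin (d - b) by apply: sin_gt0_pi; lra.
have h1 : g2 b <= g1 b.
  have -> : g2 b = q (dir b).
    by rewrite /g2 /chord_gauge subrr sin0 mul0r addr0 mulrAC divff ?mul1r ?lt0r_neq0.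
  by rewrite /g1 /chord_gauge ler_pdivlMr // mulrC gauge_between //; lra.
have h2 : g1 c <= g2 c.
  have -> : g1 c = q (dir c).
    by rewrite /g1 /chord_gauge subrr sin0 mul0r add0r mulrAC divff ?mul1r ?lt0r_neq0.
  by rewrite /g2 /chord_gauge ler_pdivlMr // mulrC gauge_between //; lra.
have [|||t] := @IVT R (fun t => g1 t - g2 t) b c 0 => //.
- apply: continuous_subspaceT => t.
  by apply: continuousB; exact: continuous_chord_gauge.
- by rewrite ge_min le_max; apply/andP; split; apply/orP; [right|left]; lra.
rewrite in_itv /= => tbc /eqP; rewrite subr_eq0 => /eqP g12.
have /andP[bt tc] := tbc.
have ac : a < c := lt_le_trans ab bc.
have bd : b < d := le_lt_trans bc cd.
have [r0 [s hs E1]] := chord_ray (g0 a) (g0 c) (le_trans (ltW ab) bt) tc ac ca.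
have [_ [s' hs' E2]] := chord_ray (g0 b) (g0 d) bt (le_trans tc (ltW cd)) bd db.
exists t, (g1 t)^-1, s, s'; split=> //; first by rewrite invr_gt0.
by split; [exact: E1|rewrite g12; exact: E2].
Qed.

(** The chord passes the ray at angle [b] no earlier than the unit curve of [g], so the form is at
    least as large there as at [radial g b]; on a chord it is bounded by its larger end value. *)
Lemma chord_support (g : plane -> R) v a b c (r r' : R) : is_gauge g ->
  0 < r -> 0 < r' -> a <= b -> b <= c -> a < c -> c < a + pi ->
  (forall s, 0 <= s <= 1 -> 1 <= g ((1 - s) *: (r *: dir a) + s *: (r' *: dir c))) ->
  0 <= dot v (radial g b) ->
  dot v (radial g b) <= dot v (r *: dir a) \/ dot v (radial g b) <= dot v (r' *: dir c).
Proof.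
move=> hg r0 r'0 ab bc ac ca hs M0.
have rV : 0 < r^-1 by rewrite invr_gt0.
have r'V : 0 < r'^-1 by rewrite invr_gt0.
have [e0 [s s01]] := chord_ray rV r'V ab bc ac ca.
rewrite !invrK; set e := chord_gauge _ _ _ _ _ in e0 *; move=> E.
have eV : 0 <= e^-1 by rewrite invr_ge0 ltW.
have := hs s s01; rewrite -E (gaugeZ hg _ eV) ler_pdivlMl // mulr1 => eg.
have g0 := gauge_dir_gt0 hg b.
have h : dot v (radial g b) <= dot v (e^-1 *: dir b).
  rewrite dotZr in M0; rewrite pmulr_rge0 ?invr_gt0 // in M0.
  by rewrite !dotZr ler_wpM2r // lef_pV2.
rewrite E dotDr !(dotZr v (1 - s)) !(dotZr v s) in h.
move: h; set M := dot v (radial g b); set A := dot v (r *: dir a).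
set C := dot v (r' *: dir c); move: s01 => /andP[s0 s1] h.
have [hA|hA] := leP M A; first by left.
right; rewrite leNgt; apply/negP => hC.
have s1' : 0 <= 1 - s by lra.
have := ler_wpM2l s1' (ltW hA); have := ler_wpM2l s0 (ltW hC) => h1 h2.
have [s00|s00] := eqVneq s 0; first by move: h; rewrite s00; lra.
have s0' : 0 < s by rewrite lt_neqAle eq_sym s00.
by have := hC; rewrite -(ltr_pM2l s0'); lra.
Qed.

(** The supremum of the parameters with [h <= k] is the point sought; continuity gives both
    inequalities for its value. *)
Lemma last_exit (h : R -> R) a b (k : R) : a < b -> continuous h ->
  h a < k -> k < h b ->
  exists t, [/\ a < t, t < b, h t = k & forall s, t < s -> s <= b -> k < h s].
Proof.
move=> ab ch ha hb; pose S := [set s : R | a <= s <= b /\ h s <= k].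
have Sa : S a by split; [rewrite lexx ltW|exact: ltW].
have Sub : has_ubound S by exists b => s [/andP[]].
have Ssup : has_sup S by split=> //; exists a.
pose t := sup S.
have at_ : a <= t by exact: ub_le_sup.
have tb : t <= b by apply: sup_le_ub; [exists a|move=> s [/andP[]]].
have after s : t < s -> s <= b -> k < h s.
  move=> ts sb; rewrite ltNge; apply/negP => hs.
  have : s <= t by apply: ub_le_sup => //; split=> //; apply/andP; split; lra.
  by lra.
have ht_le : h t <= k.
  rewrite leNgt; apply/negP => hk.
  have /nbhs_ballP[e /= e0 he] : nbhs t [set s | k < h s] by exact: cvgr_gt (ch t) _ hk.
  have [s [/andP[sa sb] sk] st] := sup_adherent e0 Ssup.
  have s_le : s <= t by apply: ub_le_sup => //; split=> //; rewrite sa.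
  have := he s; rewrite /ball /= ger0_norm ?subr_ge0 // => /(_ ltac:(rewrite -/t in st; lra)).
  by lra.
have ht_ge : k <= h t.
  rewrite leNgt; apply/negP => hk.
  have /nbhs_ballP[e /= e0 he] : nbhs t [set s | h s < k] by exact: cvgr_lt (ch t) _ hk.
  have tb' : t < b.
    by rewrite lt_neqAle tb andbT; apply/eqP => E; move: hb hk; rewrite E; lra.
  have tm : t < Num.min (t + e / 2) b by rewrite lt_min tb' andbT; lra.
  have me : Num.min (t + e / 2) b <= t + e / 2 by rewrite ge_min lexx.
  have mb : Num.min (t + e / 2) b <= b by rewrite ge_min lexx orbT.
  have := he (Num.min (t + e / 2) b); rewrite /ball /= distrC ger0_norm ?subr_ge0 ?ltW //.
  by move=> /(_ ltac:(lra)); have := after _ tm mb; lra.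
have htE : h t = k by apply/eqP; rewrite eq_le ht_le.
exists t; split=> //.
  by rewrite lt_neqAle at_ andbT; apply/eqP => E; move: ha; rewrite E htE ltxx.
by rewrite lt_neqAle tb andbT; apply/eqP => E; move: hb; rewrite -E htE ltxx.
Qed.

End Chords.

(** * The greedy walk around the parallel curve *)

Section GreedyWalk.
Context {R : realType}.
Local Notation plane := 'rV[R]_2.
Implicit Types (v x : plane) (a b c t : R) (w : nat -> R).

(** In the application [p] is the norm of B, [q] and [g] are the gauges of the parallel body and of
    F about an interior point of F, and [l] is [2 * lambda]. *)
Variables (p q g : plane -> R) (l : R).
Hypotheses (hp : is_gauge p) (pN : forall x, p (- x) = p x).
Hypotheses (hq : is_gauge q) (hg : is_gauge g) (l0 : 0 < l).
Hypothesis far_antipode : forall t, l < p (radial q (t + pi) - radial q t).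
Hypothesis short_chord : forall a c s, p (radial q c - radial q a) <= l ->
  0 <= s <= 1 -> 1 <= g ((1 - s) *: radial q a + s *: radial q c).

Definition separated_angles w k : Prop := forall i j, (i < k)%N -> (j < k)%N -> i != j ->
  l <= p (radial q (w i) - radial q (w j)).

Hypothesis separated_bounded : exists M, forall w k, separated_angles w k -> (k <= M)%N.

Let pC x y : p (x - y) = p (y - x). Proof. by rewrite -pN opprB. Qed.

(** [far_antipode] makes the distance exceed [l] at the end of a half turn, so there is a last exit
    before it. *)
Lemma greedy_step t : exists t', [/\ t < t', t' < t + pi,
  p (radial q t' - radial q t) = l &
  forall s, t' < s -> s <= t + pi -> l < p (radial q s - radial q t)].
Proof.
apply: (@last_exit R (fun s => p (radial q s - radial q t))).
- by rewrite ltrDl pi_gt0.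
- move=> s; apply: (@continuous_comp R plane R (fun s => radial q s - radial q t) p).
    by apply: cvgB; [exact: continuous_radial|exact: cvg_cst].
  exact: continuous_gauge.
- by rewrite subrr (gauge0 hp).
- exact: far_antipode.
Qed.

Lemma greedy_walk : exists step : R -> R, forall t, [/\ t < step t, step t < t + pi,
  p (radial q (step t) - radial q t) = l &
  forall s, step t < s -> s <= t + pi -> l < p (radial q s - radial q t)].
Proof. by have [step h] := choice greedy_step; exists step. Qed.

Section Walk.
Variable step : R -> R.
Hypothesis hstep : forall t, [/\ t < step t, step t < t + pi,
  p (radial q (step t) - radial q t) = l &
  forall s, step t < s -> s <= t + pi -> l < p (radial q s - radial q t)].

Lemma walk_homo t i j : (i <= j)%N -> iter i step t <= iter j step t.
Proof.
elim: j => [|j IH]; first by rewrite leqn0 => /eqP->.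
rewrite leq_eqVlt => /predU1P[->//|]; rewrite ltnS => /IH /le_trans; apply.
by rewrite iterS; case: (hstep (iter j step t)) => /ltW.
Qed.

Lemma walk_ltS t i j : (i < j)%N -> iter i step t < iter j step t.
Proof.
move=> ij; apply: lt_le_trans (walk_homo t ij).
by rewrite iterS; case: (hstep (iter i step t)).
Qed.

(** Of two points of the walk, one follows the other within half a turn, possibly across the
    closure, and lies at or beyond its greedy successor. Across the closure the successor of [wj]
    must come before [wi + pi *+ 2]; hence the bound on [iter k], one index past the last point
    used. *)
Lemma walk_separated t k : iter k step t < t + pi *+ 2 ->
  separated_angles (fun i => iter i step t) k.
Proof.
move=> hk i j ik jk ij.
wlog lt_ij : i j ik jk ij / (i < j)%N => [hw|].
  have [h|h|/eqP] := ltngtP i j; first exact: hw.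
    by rewrite pC; apply: hw; rewrite // eq_sym.
  by rewrite (negPf ij).
set wi := iter i step t; set wj := iter j step t.
have ti : t <= wi := walk_homo t (leq0n i).
have jk' : iter j.+1 step t <= iter k step t := walk_homo t jk.
have [ij'|ij'] := leP wj (wi + pi).
  rewrite pC; have [j1|j1] := eqVneq j i.+1.
    by rewrite /wj j1 iterS; case: (hstep wi) => _ _ -> _.
  apply: ltW; case: (hstep wi) => _ _ _; apply=> //.
  by rewrite -iterS; apply: walk_ltS; rewrite ltn_neqAle eq_sym j1.
rewrite -(radialD2pi q wi); apply: ltW; case: (hstep wj) => _ _ _; apply.
  by rewrite -iterS; apply: le_lt_trans jk' _; apply: lt_le_trans hk _; rewrite lerD2r.
by rewrite mulr2n addrA lerD2r ltW.
Qed.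

(** Take [k.+1] as the least number of steps that completes a turn from some start [t]. By
    minimality [k] steps complete no turn from [t], nor from [step t]; the latter is the third
    inequality. *)
Lemma walk_wraps : exists k t, [/\ iter k step t < t + pi *+ 2,
  t + pi *+ 2 <= iter k.+1 step t & iter k.+1 step t < step t + pi *+ 2].
Proof.
pose P j := `[< exists t, t + pi *+ 2 <= iter j step t >].
have exP : exists j, P j.
  have [M hM] := separated_bounded; exists M.+1; apply/asboolP; exists 0.
  rewrite leNgt; apply/negP => /walk_separated /hM; by rewrite ltnn.
case: (ex_minnP exP) => -[|k] /asboolP[t ht] hmin.
  by move: ht; have := pi_gt0 R; rewrite /=; lra.
exists k, t; split=> //; rewrite ltNge; apply/negP => h.
  have := hmin k; rewrite ltnn => h'; suff : false by [].
  by apply: h'; apply/asboolP; exists t.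
have := hmin k; rewrite ltnn => h'; suff : false by [].
by apply: h'; apply/asboolP; exists (step t); rewrite -iterSr.
Qed.

Lemma walk_between t a k : (1 <= k)%N -> step t <= a -> a < iter k step t ->
  exists i, [/\ (1 <= i)%N, (i < k)%N, iter i step t <= a & a <= iter i.+1 step t].
Proof.
elim: k => // k IH _ ta ak.
have [k0|k0] := posnP k; first by move: ak; rewrite k0 /=; lra.
have [h|h] := leP (iter k step t) a.
  by exists k; split=> //; exact: ltW.
have [i [i1 ik h1 h2]] := IH k0 ta h.
by exists i; split=> //; exact: leqW.
Qed.

End Walk.

(* The polygon has the walk's points as vertices, except that the first point
   is replaced by the crossing of the first chord with the last one. *)
Lemma greedy_polygon : exists w k y,
  [/\ separated_angles w k, y k.+1 = y 0%N, polygon_length p y k.+1 <= l * k.+1%:R &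
      forall v x, g x <= 1 -> exists2 i, (i <= k.+1)%N & dot v x <= dot v (y i)].
Proof.
have [step hstep] := greedy_walk.
have [k [t [wk tw w1]]] := walk_wraps hstep.
pose w i := iter i step t.
have st i : p (radial q (w i.+1) - radial q (w i)) = l by case: (hstep (w i)).
have sp i : w i < w i.+1 by case: (hstep (w i)).
have spi i : w i.+1 < w i + pi by case: (hstep (w i)).
have k0 : (1 <= k)%N.
  rewrite lt0n; apply/eqP => k0; move: tw; rewrite k0 -/(w 1%N).
  by have := spi 0%N; rewrite /w /=; have := pi_gt0 R; lra.
have wt : w 0%N = t by [].
have w1E : w 1%N = step t by [].
(* The last chord and the first one, moved by a full turn, have interlacing angles by [walk_wraps]
   and therefore cross. *)
have [s [r [m [m' [/andP[s1 s2] r0 hm hm' [E1 E2]]]]]] :=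
  @chords_cross R q (w k) (w 0%N + pi *+ 2) (w k.+1) (w 1%N + pi *+ 2) hq
    wk tw w1 (spi k) ltac:(rewrite addrAC ltrD2r; exact: (spi 0%N)).
rewrite !radialD2pi in E2.
pose Q := r *: dir s; rewrite -/Q in E1 E2.
pose y i := if (1 <= i <= k)%N then radial q (w i) else Q.
have y0 : y 0%N = Q by [].
have yk : y k.+1 = Q by rewrite /y ltnn andbF.
have yi i : (1 <= i)%N -> (i <= k)%N -> y i = radial q (w i).
  by move=> h1 h2; rewrite /y h1 h2.
(* There are [k] separated points, [w 0] to [w (k - 1)], against [k.+1] edges; the extra edge is the
   term [2 * lambda] lost in the lower bound. *)
exists w, k, y; split.
- exact: walk_separated.
- by rewrite yk.
- rewrite /polygon_length big_nat.
  have -> : l * k.+1%:R = \sum_(0 <= i < k.+1 | (0 <= i < k.+1)%N) l.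
    by rewrite -big_nat sumr_const_nat subn0 mulr_natr.
  apply: ler_sum => i /andP[_]; rewrite ltnS => ik.
  (* The first and the last edge are pieces of the two crossing chords, all other edges are full
     chords; none is longer than [l]. *)
  have [i0|i0] := posnP i.
    have convB (u v : plane) (z : R) : v - ((1 - z) *: u + z *: v) = (1 - z) *: (v - u).
      by apply/rowP => j; rewrite !mxE; ring.
    rewrite i0 y0 yi // E2 convB.
    rewrite (gaugeZ hp) ?st ?subr_ge0; last by case/andP: hm'.
    by rewrite ger_pMl // gerBl; case/andP: hm'.
  have [ik'|ik'] := eqVneq i k.
    have convB (u v : plane) (z : R) : (1 - z) *: u + z *: v - u = z *: (v - u).
      by apply/rowP => j; rewrite !mxE; ring.
    rewrite ik' yk yi // E1 convB.
    rewrite (gaugeZ hp) ?st; last by case/andP: hm.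
    by rewrite ger_pMl //; case/andP: hm.
  have ik2 : (i < k)%N by rewrite ltn_neqAle ik'.
  by rewrite (yi i.+1 isT ik2) (yi i i0 ik) st.
- move=> v x gx.
  have [t0 ht0] := radial_dot_max hg v.
  have M0 := radial_dot_max_ge0 hg ht0.
  (* The supporting direction gets an angle in the turn starting at [w 1], which the vertices split
     into full chords, the piece from [w k] to [Q], and the piece from [Q] to [w 1]. *)
  have [t1 [r1 [t1a t1b r10 E]]] := polar_from (w 1%N) (dir_neq0 t0).
  have rE : radial g t0 = radial g t1.
    rewrite /radial E (gaugeZ hg _ (ltW r10)) scalerA; congr (_ *: _).
    by rewrite invfM mulrAC mulVf ?mul1r // lt0r_neq0.
  rewrite rE in ht0 M0.
  have xM : dot v x <= dot v (radial g t1).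
    by apply: le_trans (ht0 x) _; rewrite ler_piMl.
  suff [i ik h] : exists2 i, (i <= k.+1)%N & dot v (radial g t1) <= dot v (y i).
    by exists i => //; exact: le_trans h.
  have iq u : 0 < (q (dir u))^-1 by rewrite invr_gt0 gauge_dir_gt0.
  have sc i z : 0 <= z <= 1 ->
      1 <= g ((1 - z) *: radial q (w i) + z *: radial q (w i.+1)).
    by move=> hz; apply: short_chord => //; rewrite st.
  have [h|h] := leP (w k) t1; last first.
    have [i [i1 ik h1 h2]] := walk_between k0 t1a h.
    have [] := chord_support (v := v) hg (iq (w i)) (iq (w i.+1)) h1 h2 (sp i) (spi i) _ M0.
    + exact: sc.
    + move=> h3; exists i; first exact: leqW (ltnW ik).
      by rewrite (yi i i1 (ltnW ik)); exact: h3.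
    + move=> h3; exists i.+1; first exact: leqW ik.
      by rewrite (yi i.+1 isT ik); exact: h3.
  have [ts|ts] := leP t1 s.
    have wks : w k < s by exact: lt_le_trans wk s1.
    have swk : s < w k + pi by exact: le_lt_trans s2 (spi k).
    have [] := chord_support (v := v) hg (iq (w k)) r0 h ts wks swk _ M0.
    + move=> z hz; rewrite -/(radial q (w k)) -/Q E1.
      (* A point of the piece from [w k] to [Q] is a point of the last chord, with parameter
         [z * m]. *)
      have -> : (1 - z) *: radial q (w k) +
          z *: ((1 - m) *: radial q (w k) + m *: radial q (w k.+1)) =
          (1 - z * m) *: radial q (w k) + (z * m) *: radial q (w k.+1).
        by rewrite scalerDr !scalerA addrA -scalerDl; congr (_ *: _ + _); ring.
      apply: sc; move: hz hm => /andP[? ?] /andP[? ?].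
      by rewrite mulr_ge0 // mulr_ile1.
    + move=> h3; exists k; first exact: leqnSn.
      by rewrite (yi k k0 (leqnn k)); exact: h3.
    + by move=> h3; exists 0%N => //; rewrite y0; exact: h3.
  have sw1 : s < w 1%N + pi *+ 2 by exact: le_lt_trans s2 w1.
  have w1s : w 1%N + pi *+ 2 < s + pi.
    by have := spi 0%N; move: s1; rewrite wt /w; lra.
  have [] := chord_support (v := v) hg r0 (iq (w 1%N + pi *+ 2)) (ltW ts) (ltW t1b) sw1 w1s _ M0.
  + move=> z hz; rewrite -/(radial q (w 1%N + pi *+ 2)) radialD2pi -/Q E2.
    (* On the piece from [Q] to [w 1] the complementary parameters [1 - z] and [1 - m'] multiply
       instead. *)
    have -> : (1 - z) *: ((1 - m') *: radial q (w 0%N) + m' *: radial q (w 1%N)) +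
        z *: radial q (w 1%N) =
        (1 - (1 - (1 - z) * (1 - m'))) *: radial q (w 0%N) +
        (1 - (1 - z) * (1 - m')) *: radial q (w 1%N).
      rewrite scalerDr !scalerA -addrA -scalerDl.
      by congr (_ *: _ + _ *: _); ring.
    apply: sc; move: hz hm' => /andP[? ?] /andP[? ?].
    have h1 : 0 <= (1 - z) * (1 - m') by rewrite mulr_ge0 ?subr_ge0.
    have h2 : (1 - z) * (1 - m') <= 1 by rewrite mulr_ile1 ?subr_ge0 ?gerBl.
    by rewrite subr_ge0 h2 gerBl.
  + by move=> h3; exists 0%N => //; rewrite y0; exact: h3.
  + rewrite -/(radial q (w 1%N + pi *+ 2)) radialD2pi => h3; exists 1%N => //.
    by rewrite (yi 1%N isT k0); exact: h3.
Qed.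

End GreedyWalk.

(** * The lower bound and the conclusion *)

Lemma touching_packing_ge (R : realType) (c : 'rV[R]_2) (B F : set 'rV[R]_2)
    (lambda : R) : symmetric_oval c B -> convex_disk F -> 0 < lambda ->
  exists2 k, touching_packing F B lambda k &
    (closed_curve_length c B (boundary F) <= (2 * lambda * k.+1%:R)%:E)%E.
Proof.
move=> hB hF l0; have [z Fz] : F° !=set0 by case: hF.
pose q := oval_norm z (parallel_body B F c lambda).
have hG := parallel_body_disk hB hF l0.
have Gz := parallel_body_center hB l0 Fz.
have hp := oval_is_gauge hB.1 (symmetric_oval_center hB).
have hq : is_gauge q := oval_is_gauge hG Gz.
have hg := oval_is_gauge hF Fz.
have tr := touches_radial hB hF l0 Fz.
have dE s t : radial q s - radial q t = z + radial q s - (z + radial q t).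
  by rewrite opprD addrACA subrr add0r.
have packing w k : separated_angles (oval_norm c B) q (2 * lambda) w k ->
    touching_packing F B lambda k.
  move=> sw; apply/(touching_packingP F hB l0).
  exists (fun i => z + radial q (w i)); split=> [i|i j ij]; first exact: tr.
  by rewrite -dE; apply: sw.
have chord a b s : oval_norm c B (radial q b - radial q a) <= 2 * lambda ->
    0 <= s <= 1 -> 1 <= oval_norm z F ((1 - s) *: radial q a + s *: radial q b).
  rewrite dE => ab s01.
  have := short_chord_misses_interior hB hF l0 Fz (tr a) (tr b) ab s01.
  have convD (u v w : 'rV[R]_2) : (1 - s) *: (w + u) + s *: (w + v) - w =
      (1 - s) *: u + s *: v by apply/rowP => i; rewrite !mxE; ring.
  by rewrite convD.
have bounded : exists M, forall w k,
    separated_angles (oval_norm c B) q (2 * lambda) w k -> (k <= M)%N.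
  have [M hM] := touching_packing_bounded hB hF l0 Fz.
  by exists M => w k /packing/hM.
have l2 : 0 < 2 * lambda by rewrite mulr_gt0.
have [w [k [y [sw yk ylen ysup]]]] := greedy_polygon hp (oval_normN hB) hq hg l2
  (antipodal_dist hB hF l0 Fz) chord bounded.
exists k; first exact: packing sw.
pose y' i := z + y i.
have y'k : y' k.+1 = y' 0%N by rewrite /y' yk.
apply: le_trans (perimeter_le_polygon hB hF Fz y'k _) _.
  move=> v x Fx; have [|i ik h] := ysup v (x - z).
    by apply/(oval_le1 hF Fz); rewrite addrC subrK.
  by exists i => //; rewrite /y' dotDr -lerBlDl -dotBr.
rewrite lee_fin; apply: le_trans ylen.
by apply: ler_sum => i _; rewrite /y' opprD addrACA subrr add0r.
Qed.

Theorem proposition6 (R : realType) (c : 'rV[R]_2) (B F : set 'rV[R]_2)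
    (hB : symmetric_oval c B) (hF : convex_disk F)
    (lambda : R) (hlambda : 0 < lambda) :
  exists N : nat,
    [/\ is_touching_number F B lambda N,
        (closed_curve_length c B (boundary F) - (2 * lambda)%:E
           <= (2 * lambda * N%:R)%:E)%E
      & ((2 * lambda * N%:R)%:E
           <= closed_curve_length c B (boundary F)
              + lambda%:E * closed_curve_length c B (boundary B))%E].
Proof.
have [k hk pk] := touching_packing_ge hB hF hlambda.
have [z Fz] : F° !=set0 by case: hF.
have [M hM] := touching_packing_bounded hB hF hlambda Fz.
have exP : exists n, `[< touching_packing F B lambda n >] by exists k; apply/asboolP.
have ubP n : `[< touching_packing F B lambda n >] -> (n <= M)%N by move=> /asboolP/hM.
case: (ex_maxnP exP ubP) => N /asboolP hN maxN.
have maxN' n : touching_packing F B lambda n -> (n <= N)%N.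
  by move=> h; apply: maxN; apply/asboolP.
exists N; split; [by split| |exact: (touching_packing_le hB hF hlambda Fz hN)].
(* The greedy packing bounds the perimeter by [2 * lambda * k.+1], and [k <= N] by maximality. *)
rewrite leeBlDr // -EFinD; apply: le_trans pk _; rewrite lee_fin.
have kN : k%:R <= N%:R :> R by rewrite ler_nat maxN'.
by rewrite -[k.+1%:R]natr1 mulrDr mulr1 lerD2r ler_pM2l // mulr_gt0.
Qed.
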